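(* Let $R$ be a commutative ring, $X=\operatorname{Spec} R$, and let $N\xrightarrow{\alpha}M\xrightarrow{\beta}L$ be a complex of finitely generated $R$-modules. Then the following are equivalent (where for (v) suppose that $R$ is noetherian of finite dimension and contains a field of characteristic $0$). (i) The complex of sheaves $N_{\mathrm{surj}}\to M_{\mathrm{surj}}\to L_{\mathrm{surj}}$ on $(\operatorname{Spec} R)_{\mathrm{surj}}$ is exact (where the category of the surjective topology contains all $R$-algebras or all $R$-algebras of finite type). (ii) For every ring homomorphism $R\to R'$ (of finite type) the complex $N\otimes_RR'\to M\otimes_RR'\to L\otimes_RR'$ is such that the kernel lies inside the radical of the image. (iii) The complex $N\otimes_R\operatorname{rad}(R)\to M\otimes_R\operatorname{rad}(R)\to L\otimes_R\operatorname{rad}(R)$ of $\operatorname{rad}(R)$-modules is exact. (iv) For every ring homomorphism $R\to K$ to a field $K$ the complex $N\otimes_RK\to M\otimes_RK\to L\otimes_RK$ of $K$-vector spaces is exact. (v) The complex of global sections $\Gamma(R',N_{\mathrm{surj}})\to\Gamma(R',M_{\mathrm{surj}})\to\Gamma(R',L_{\mathrm{surj}})$ is exact for all ring homomorphisms $R\to R'$ of finite type.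
   Context: Surjective topology on $X=\operatorname{Spec} R$: the category is the full subcategory of schemes (or schemes of finite type) affine over $X$, i.e. given by all $R$-algebras (or all $R$-algebras of finite type); the coverings are the single affine surjective morphisms $V\to U$ of finite type over $X$. For an $R$-module $M$, $M_{\mathrm{surj}}$ is the sheafification of the presheaf $\operatorname{Spec} S\mapsto M\otimes_RS$, and $\Gamma(R',M_{\mathrm{surj}})$ means its sections over $\operatorname{Spec} R'$. A complex of sheaves $\mathcal G\to\mathcal F\to\mathcal E$ is exact if for every object $U$ and every $s\in\Gamma(U,\mathcal F)$ mapping to $0$ in $\Gamma(U,\mathcal E)$ there is a covering of $U$ on which $s$ comes from sections of $\mathcal G$. For $R'$-modules $N'\subseteq M'$ the radical of $N'$ in $M'$ is $\operatorname{rad}(N')=\{s\in M': s\otimes1\in\operatorname{im}(N'\otimes_{R'}K\to M'\otimes_{R'}K)\text{ for all ring homomorphisms }R'\to K\text{ to fields}\}$. Furthermore $\operatorname{rad}(R):=\prod_{x\in\operatorname{Spec} R}\overline{\kappa(x)}$, where $\overline{\kappa(x)}$ is an algebraic closure of the residue field at $x$, an $R$-algebra in the natural way. *)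

(* Defs.v *)
From HB Require Import structures.
From mathcomp Require Import all_boot all_algebra boolp ring.

Set Implicit Arguments.
Unset Strict Implicit.
Unset Printing Implicit Defensive.

Import GRing.Theory.
Local Open Scope ring_scope.
Local Open Scope quotient_scope.

(* [base_change phi M] is M ⊗_R S for phi : R -> S: finite formal sums of pairs
   (m, s), two of which are identified iff every R-balanced biadditive map
   takes the same value on them. *)

Section BaseChange.
Variables (R S : comPzRingType) (phi : {rmorphism R -> S}) (M : lmodType R).

Definition balanced (A : zmodType) (b : M -> S -> A) : Prop :=
  [/\ forall m m' s, b (m + m') s = b m s + b m' s,
      forall m s s', b m (s + s') = b m s + b m s' &
      forall a m s, b (a *: m) s = b m (phi a * s)].

Definition formal_value (A : zmodType) (b : M -> S -> A) (t : seq (M * S)) : A :=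
  \sum_(p <- t) b p.1 p.2.

Definition tensor_eq (t u : seq (M * S)) : bool :=
  `[< forall (A : zmodType) (b : M -> S -> A),
        balanced b -> formal_value b t = formal_value b u >].

Lemma tensor_eqP t u :
  reflect (forall (A : zmodType) (b : M -> S -> A),
             balanced b -> formal_value b t = formal_value b u)
          (tensor_eq t u).
Proof. exact: asboolP. Qed.

Lemma tensor_eq_refl : reflexive tensor_eq.
Proof. by move=> t; apply/tensor_eqP. Qed.

Lemma tensor_eq_sym : symmetric tensor_eq.
Proof.
by move=> t u; apply/tensor_eqP/tensor_eqP => tu A b bb; rewrite tu.
Qed.

Lemma tensor_eq_trans : transitive tensor_eq.
Proof.
move=> u t v /tensor_eqP tu /tensor_eqP uv; apply/tensor_eqP => A b bb.
by rewrite tu // uv.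
Qed.

Canonical tensor_eq_equiv :=
  EquivRel tensor_eq tensor_eq_refl tensor_eq_sym tensor_eq_trans.

Definition base_change : Type := {eq_quot tensor_eq}.

HB.instance Definition _ : EqQuotient _ tensor_eq base_change :=
  EqQuotient.on base_change.
HB.instance Definition _ := Choice.on base_change.

Definition formal_class (t : seq (M * S)) : base_change := \pi_base_change t.

Definition pure (m : M) (s : S) : base_change := formal_class [:: (m, s)].

Definition tensor_value (A : zmodType) (b : M -> S -> A) (x : base_change) : A :=
  formal_value b (repr x).

Lemma formal_classE t u : formal_class t = formal_class u <-> tensor_eq t u.
Proof. by split=> [/eqmodP|tu]; last apply/eqmodP. Qed.

Lemma tensor_value_class (A : zmodType) (b : M -> S -> A) t :
  balanced b -> tensor_value b (formal_class t) = formal_value b t.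
Proof.
move=> bb; have /formal_classE/tensor_eqP : formal_class (repr (formal_class t))
  = formal_class t by rewrite /formal_class reprK.
exact.
Qed.

Lemma formal_classP (x : base_change) : formal_class (repr x) = x.
Proof. exact: reprK. Qed.

Lemma base_change_ext (x y : base_change) :
  (forall (A : zmodType) (b : M -> S -> A),
     balanced b -> tensor_value b x = tensor_value b y) -> x = y.
Proof.
move=> xy; rewrite -[x]formal_classP -[y]formal_classP.
by apply/formal_classE/tensor_eqP.
Qed.

Definition bc_zero : base_change := formal_class [::].
Definition bc_opp (x : base_change) : base_change :=
  formal_class [seq (- p.1, p.2) | p <- repr x].
Definition bc_add (x y : base_change) : base_change :=
  formal_class (repr x ++ repr y).
Definition bc_scale (s : S) (x : base_change) : base_change :=
  formal_class [seq (p.1, s * p.2) | p <- repr x].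

Section Values.
Variables (A : zmodType) (b : M -> S -> A) (bb : balanced b).

Lemma balanced0l s : b 0 s = 0.
Proof. by case: bb => bD _ _; apply: (addrI (b 0 s)); rewrite -bD !addr0. Qed.

Lemma balancedNl m s : b (- m) s = - b m s.
Proof.
by case: bb => bD _ _; apply: (addrI (b m s)); rewrite -bD !subrr balanced0l.
Qed.

Lemma tensor_value0 : tensor_value b bc_zero = 0.
Proof. by rewrite tensor_value_class // /formal_value big_nil. Qed.

Lemma tensor_valueN x : tensor_value b (bc_opp x) = - tensor_value b x.
Proof.
rewrite tensor_value_class // /formal_value big_map -sumrN.
by apply: eq_bigr => p _; rewrite balancedNl.
Qed.

Lemma tensor_valueD x y :
  tensor_value b (bc_add x y) = tensor_value b x + tensor_value b y.
Proof. by rewrite tensor_value_class // /formal_value big_cat. Qed.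

Lemma balanced_scale s : balanced (fun m s' => b m (s * s')).
Proof.
case: bb => bD1 bD2 bZ; split=> [m m' t|m t t'|a m t]; rewrite ?mulrDr //.
by rewrite bZ mulrCA.
Qed.

Lemma tensor_valueZ s x :
  tensor_value b (bc_scale s x) = tensor_value (fun m s' => b m (s * s')) x.
Proof. by rewrite tensor_value_class // /formal_value big_map. Qed.

End Values.

Lemma bc_addA : associative bc_add.
Proof.
by move=> x y z; apply: base_change_ext => A b bb; rewrite !tensor_valueD // addrA.
Qed.
Lemma bc_addC : commutative bc_add.
Proof.
by move=> x y; apply: base_change_ext => A b bb; rewrite !tensor_valueD // addrC.
Qed.
Lemma bc_add0 : left_id bc_zero bc_add.
Proof.
move=> x; apply: base_change_ext => A b bb.
by rewrite tensor_valueD // tensor_value0 // add0r.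
Qed.
Lemma bc_addN : left_inverse bc_zero bc_opp bc_add.
Proof.
move=> x; apply: base_change_ext => A b bb.
by rewrite tensor_valueD // tensor_valueN // tensor_value0 // addNr.
Qed.

HB.instance Definition _ :=
  GRing.isZmodule.Build base_change bc_addA bc_addC bc_add0 bc_addN.

Lemma bc_scaleA a b x : bc_scale a (bc_scale b x) = bc_scale (a * b) x.
Proof.
apply: base_change_ext => A f ff; rewrite tensor_valueZ // tensor_valueZ.
  by rewrite tensor_valueZ //; congr tensor_value; apply/funext => m;
     apply/funext => s; rewrite mulrA.
exact: balanced_scale.
Qed.
Lemma bc_scale1 : left_id 1 bc_scale.
Proof.
move=> x; apply: base_change_ext => A f ff; rewrite tensor_valueZ //.
by congr tensor_value; apply/funext => m; apply/funext => s; rewrite mul1r.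
Qed.
Lemma bc_scaleDr : right_distributive bc_scale +%R.
Proof.
move=> a x y; apply: base_change_ext => A f ff.
rewrite tensor_valueZ // !tensor_valueD ?tensor_valueZ //.
exact: balanced_scale.
Qed.
Lemma bc_scaleDl x : {morph bc_scale^~ x : a b / a + b}.
Proof.
move=> a b /=; apply: base_change_ext => A f ff.
rewrite tensor_valueD // !tensor_valueZ // -big_split /=.
by apply: eq_bigr => p _; case: ff => _ fD _; rewrite mulrDl fD.
Qed.

HB.instance Definition _ :=
  GRing.Zmodule_isLmodule.Build S base_change
    bc_scaleA bc_scale1 bc_scaleDr bc_scaleDl.

Lemma pure_balanced : balanced pure.
Proof.
by split=> [m m' s|m s s'|a m s]; apply: base_change_ext => A b bb;
   rewrite ?tensor_valueD // /pure !tensor_value_class // /formal_value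
           !big_seq1 /=; case: bb => *.
Qed.

Lemma scale_pure s m s' : s *: pure m s' = pure m (s * s').
Proof.
apply: base_change_ext => A b bb; rewrite tensor_valueZ //.
rewrite !tensor_value_class //; last exact: balanced_scale.
by rewrite /formal_value !big_seq1.
Qed.

Lemma tensor_value_additive (A : zmodType) (b : M -> S -> A) :
  balanced b -> zmod_morphism (tensor_value b).
Proof. by move=> bb x y; rewrite tensor_valueD // tensor_valueN. Qed.

Lemma tensor_value_pure (A : zmodType) (b : M -> S -> A) m s :
  balanced b -> tensor_value b (pure m s) = b m s.
Proof. by move=> bb; rewrite tensor_value_class // /formal_value big_seq1. Qed.

Lemma base_change_sum (x : base_change) : x = \sum_(p <- repr x) pure p.1 p.2.
Proof.
rewrite -{1}[x]formal_classP; elim: (repr x) => [|p t IH]; first by rewrite big_nil.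
rewrite big_cons -IH; apply: base_change_ext => A b bb.
rewrite tensor_valueD // tensor_value_pure // !tensor_value_class //.
by rewrite /formal_value big_cons.
Qed.

Lemma base_change_ind (P : base_change -> Prop) :
  P 0 -> (forall m s x, P x -> P (pure m s + x)) -> forall x, P x.
Proof.
move=> P0 PD x; rewrite [x]base_change_sum; elim: (repr x) => [|p t IH].
  by rewrite big_nil.
by rewrite big_cons; apply: PD.
Qed.

End BaseChange.

Section BaseChangeMap.
Variables (R S : comPzRingType) (phi : {rmorphism R -> S}).
Variables (M M' : lmodType R) (f : {linear M -> M'}).

Lemma bc_map_balanced : balanced phi (fun m s => pure phi (f m) s).
Proof.
case: (pure_balanced phi M') => D1 D2 Z.
by split=> *; rewrite ?linearD ?linearZ /= ?D1 ?D2 ?Z.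
Qed.

Definition bc_map : base_change phi M -> base_change phi M' :=
  tensor_value (fun m s => pure phi (f m) s).

Lemma bc_map_pure m s : bc_map (pure phi m s) = pure phi (f m) s.
Proof. exact: tensor_value_pure bc_map_balanced. Qed.

HB.instance Definition _ := GRing.isZmodMorphism.Build _ _ bc_map
  (tensor_value_additive bc_map_balanced).

Lemma bc_map_scalable : scalable bc_map.
Proof.
move=> s x; elim/base_change_ind: x => [|m t x IH]; first by rewrite scaler0 (raddf0 bc_map) scaler0.
by rewrite scalerDr !(raddfD bc_map) /= scale_pure !bc_map_pure IH scalerDr scale_pure.
Qed.

HB.instance Definition _ := GRing.isScalable.Build _ _ _ _ bc_map bc_map_scalable.

End BaseChangeMap.
Arguments bc_map {R S} phi {M M'} f _.

Section BaseChangeRes.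
Variables (R S T : comPzRingType) (phi : {rmorphism R -> S}).
Variables (psi : {rmorphism R -> T}) (h : {rmorphism S -> T}).
Hypothesis hP : forall r, h (phi r) = psi r.
Variable M : lmodType R.

Lemma bc_res_balanced : balanced phi (fun (m : M) s => pure psi m (h s)).
Proof.
case: (pure_balanced psi M) => D1 D2 Z.
by split=> *; rewrite ?D1 ?rmorphD ?D2 ?Z ?rmorphM ?hP.
Qed.

(* The proof argument makes [bc_res] depend on h being a morphism of
   R-algebras, without which the formula is not well defined. *)
Definition bc_res of (forall r, h (phi r) = psi r) :
    base_change phi M -> base_change psi M :=
  tensor_value (fun m s => pure psi m (h s)).

Lemma bc_res_pure m s : bc_res hP (pure phi m s) = pure psi m (h s).
Proof. exact: tensor_value_pure bc_res_balanced. Qed.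

HB.instance Definition _ := GRing.isZmodMorphism.Build _ _ (bc_res hP)
  (tensor_value_additive bc_res_balanced).

End BaseChangeRes.

Definition exact_at (R : pzRingType) (N M L : lmodType R)
    (f : N -> M) (g : M -> L) : Prop :=
  forall m, g m = 0 <-> exists n, f n = m.

Definition exact_after (R S : comPzRingType) (phi : {rmorphism R -> S})
    (N M L : lmodType R) (f : {linear N -> M}) (g : {linear M -> L}) : Prop :=
  exact_at (bc_map phi f) (bc_map phi g).

Definition fg_module (R : pzRingType) (M : lmodType R) : Prop :=
  exists (n : nat) (e : 'I_n -> M),
    forall m, exists c : 'I_n -> R, m = \sum_i c i *: e i.

Definition is_ideal (R : comPzRingType) (I : {pred R}) : Prop :=
  0 \in I /\ forall a u v, u \in I -> v \in I -> a * u + v \in I.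

Definition is_prime (R : comPzRingType) (I : {pred R}) : Prop :=
  [/\ is_ideal I, 1 \notin I &
      forall u v, u * v \in I -> u \in I \/ v \in I].

(* A function into bool rather than a {pred R}: it keeps spec R in the universe of
   R, so that a product of fields over spec R is again a ring of that universe. *)
Record spec (R : comPzRingType) := Spec {
  prime_pred : R -> bool;
  prime_idealP : is_prime prime_pred }.

Coercion prime_ideal (R : comPzRingType) (p : spec R) : {pred R} := prime_pred p.

Definition spec_surjective (A B : comPzRingType) (f : {rmorphism A -> B}) : Prop :=
  forall p : spec A, exists q : spec B, forall a, (f a \in q) = (a \in p).

Definition noetherian (R : comPzRingType) : Prop :=
  forall I : {pred R}, is_ideal I ->
    exists (n : nat) (e : 'I_n -> R), (forall i, e i \in I) /\
      forall a, a \in I -> exists c : 'I_n -> R, a = \sum_i c i * e i.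

Definition finite_krull_dim (R : comPzRingType) : Prop :=
  exists d : nat, forall (n : nat) (p : 'I_n.+1 -> spec R),
    (forall i j : 'I_n.+1, (i < j)%N ->
       {subset p i <= p j} /\ ~ {subset p j <= p i}) ->
    (n <= d)%N.

Definition contains_char0_field (R : comPzRingType) : Prop :=
  exists (F : fieldType) (i : {rmorphism F -> R}),
    injective i /\ [pchar F] =i pred0.

Definition finite_type (A B : comPzRingType) (f : {rmorphism A -> B}) : Prop :=
  exists s : seq B, forall P : {pred B},
    subring_closed P -> (forall a, f a \in P) -> {subset s <= P} ->
    forall b, b \in P.

Record submodule (R : comPzRingType) (M : lmodType R) := Submodule {
  sub_pred :> {pred M};
  sub_predP : submod_closed sub_pred }.

Section SubmoduleType.
Variables (R : comPzRingType) (M : lmodType R) (N : submodule M).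

Definition sub_mem : {pred M} := fun m => m \in sub_pred N.

HB.instance Definition _ :=
  GRing.isSubmodClosed.Build R M sub_mem (sub_predP N).

Definition sub_type : Type := {m : M | sub_mem m}.

HB.instance Definition _ := [isSub of sub_type for @sval M sub_mem].
HB.instance Definition _ := [Choice of sub_type by <:].
HB.instance Definition _ := [SubChoice_isSubLmodule of sub_type by <:].

Definition sub_incl : {linear sub_type -> M} := val.

End SubmoduleType.

Definition in_radical (R : comPzRingType) (M : lmodType R) (N : submodule M)
    (m : M) : Prop :=
  forall (K : fieldType) (k : {rmorphism R -> K}),
    exists z : base_change k (sub_type N), bc_map k (sub_incl N) z = pure k m 1.

Section Image.
Variables (R : comPzRingType) (N M : lmodType R) (f : {linear N -> M}).

Definition image_pred : {pred M} := fun m => `[< exists n, f n = m >].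

Lemma image_predP : submod_closed image_pred.
Proof.
split; first by apply/asboolP; exists 0; rewrite linear0.
move=> a _ _ /asboolP[x <-] /asboolP[y <-].
by apply/asboolP; exists (a *: x + y); rewrite linearP.
Qed.

Definition image_of : submodule M := Submodule image_predP.
End Image.

(* κ(x) = Frac(R/x): fractions a/b with a, b in R and b not in x, where
   a/b = c/d iff ad - cb is in x. *)

Section ResidueField.
Variables (R : comPzRingType) (x : spec R).

Lemma prime_ideal0 : 0 \in prime_ideal x.
Proof. by case: (prime_idealP x) => -[]. Qed.
Lemma prime_idealD a b : a \in prime_ideal x -> b \in prime_ideal x ->
  a + b \in prime_ideal x.
Proof. by case: (prime_idealP x) => -[_ xD] _ _ ax bx; rewrite -[a]mul1r xD. Qed.
Lemma prime_idealMl a b : b \in prime_ideal x -> a * b \in prime_ideal x.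
Proof.
by case: (prime_idealP x) => -[x0 xD] _ _ bx; rewrite -[_ * _]addr0 xD.
Qed.
Lemma prime_idealN a : a \in prime_ideal x -> - a \in prime_ideal x.
Proof. by rewrite -mulN1r; apply: prime_idealMl. Qed.
Lemma prime_ideal1 : 1 \notin prime_ideal x.
Proof. by case: (prime_idealP x). Qed.
Lemma prime_idealVl a b : a \notin prime_ideal x -> a * b \in prime_ideal x ->
  b \in prime_ideal x.
Proof. by case: (prime_idealP x) => _ _ xM /negP ax /xM[]. Qed.
Lemma prime_idealM a b : a \notin prime_ideal x -> b \notin prime_ideal x ->
  a * b \notin prime_ideal x.
Proof. by move=> ax; apply: contra; apply: prime_idealVl. Qed.

Definition rf_frac := {p : R * R | p.2 \notin prime_ideal x}.
Implicit Types p q r : rf_frac.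
Definition rf_num p : R := (val p).1.
Definition rf_den p : R := (val p).2.
Definition mk_rf_frac (a b : R) (bx : b \notin prime_ideal x) : rf_frac :=
  exist _ (a, b) bx.

Lemma rf_denP p : rf_den p \notin prime_ideal x.
Proof. exact: (valP p). Qed.

Definition frac_eq p q : bool := rf_num p * rf_den q - rf_num q * rf_den p \in prime_ideal x.

Lemma frac_eq_refl : reflexive frac_eq.
Proof. by move=> p; rewrite /frac_eq subrr prime_ideal0. Qed.
Lemma frac_eq_sym : symmetric frac_eq.
Proof.
by move=> p q; apply/idP/idP => /prime_idealN; rewrite opprB.
Qed.
Lemma frac_eq_trans : transitive frac_eq.
Proof.
move=> q p r; rewrite /frac_eq => pq qr.
apply: (prime_idealVl (rf_denP q)).
rewrite (_ : _ * _ = rf_den r * (rf_num p * rf_den q - rf_num q * rf_den p)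
                   + rf_den p * (rf_num q * rf_den r - rf_num r * rf_den q)).
  by apply: prime_idealD; apply: prime_idealMl.
by ring.
Qed.

Canonical frac_eq_equiv :=
  EquivRel frac_eq frac_eq_refl frac_eq_sym frac_eq_trans.

Definition residue_field : Type := {eq_quot frac_eq}.

HB.instance Definition _ : EqQuotient _ frac_eq residue_field :=
  EqQuotient.on residue_field.
HB.instance Definition _ := Choice.on residue_field.

Definition frac_class p : residue_field := \pi_residue_field p.

Lemma frac_classE p q : frac_class p = frac_class q <-> frac_eq p q.
Proof. by split=> [/eqmodP|pq]; last apply/eqmodP. Qed.
Lemma frac_classK (u : residue_field) : frac_class (repr u) = u.
Proof. exact: reprK. Qed.
Lemma frac_repr p : frac_eq (repr (frac_class p)) p.
Proof. by apply/frac_classE; rewrite frac_classK. Qed.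
Lemma frac_classW (P : residue_field -> Prop) :
  (forall p, P (frac_class p)) -> forall u, P u.
Proof. by move=> Pp u; rewrite -[u]frac_classK. Qed.

Definition to_frac (a : R) : rf_frac := mk_rf_frac a prime_ideal1.
Definition frac_add p q : rf_frac :=
  mk_rf_frac (rf_num p * rf_den q + rf_num q * rf_den p) (prime_idealM (rf_denP p) (rf_denP q)).
Definition frac_opp p : rf_frac := mk_rf_frac (- rf_num p) (rf_denP p).
Definition frac_mul p q : rf_frac :=
  mk_rf_frac (rf_num p * rf_num q) (prime_idealM (rf_denP p) (rf_denP q)).

Definition rf_add (u v : residue_field) := frac_class (frac_add (repr u) (repr v)).
Definition rf_opp (u : residue_field) := frac_class (frac_opp (repr u)).
Definition rf_mul (u v : residue_field) := frac_class (frac_mul (repr u) (repr v)).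
Definition rf_inv (u : residue_field) : residue_field :=
  if boolP (rf_num (repr u) \notin prime_ideal x) is AltTrue nz
  then frac_class (mk_rf_frac (rf_den (repr u)) nz) else frac_class (to_frac 0).

Lemma rf_addE p q :
  rf_add (frac_class p) (frac_class q) = frac_class (frac_add p q).
Proof.
apply/frac_classE; rewrite /frac_eq /=; have := frac_repr p; have := frac_repr q.
rewrite /frac_eq; set p' := repr (frac_class p); set q' := repr (frac_class q) => qx px.
rewrite (_ : _ - _ =
  (rf_den q' * rf_den q) * (rf_num p' * rf_den p - rf_num p * rf_den p') +
  (rf_den p' * rf_den p) * (rf_num q' * rf_den q - rf_num q * rf_den q')); last first.
  by rewrite /frac_add /mk_rf_frac /rf_num /rf_den /=; ring.
by apply: prime_idealD; apply: prime_idealMl.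
Qed.

Lemma rf_oppE p : rf_opp (frac_class p) = frac_class (frac_opp p).
Proof.
apply/frac_classE; rewrite /frac_eq /=; have := frac_repr p.
rewrite /frac_eq; set p' := repr _ => px.
rewrite (_ : _ - _ = - (rf_num p' * rf_den p - rf_num p * rf_den p')); last first.
  by rewrite /frac_opp /mk_rf_frac /rf_num /rf_den /=; ring.
exact: prime_idealN.
Qed.

Lemma rf_mulE p q :
  rf_mul (frac_class p) (frac_class q) = frac_class (frac_mul p q).
Proof.
apply/frac_classE; rewrite /frac_eq /=; have := frac_repr p; have := frac_repr q.
rewrite /frac_eq; set p' := repr (frac_class p); set q' := repr (frac_class q) => qx px.
rewrite (_ : _ - _ =
   (rf_num q' * rf_den q) * (rf_num p' * rf_den p - rf_num p * rf_den p') +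
   (rf_num p * rf_den p') * (rf_num q' * rf_den q - rf_num q * rf_den q')); last first.
  by rewrite /frac_mul /mk_rf_frac /rf_num /rf_den /=; ring.
by apply: prime_idealD; apply: prime_idealMl.
Qed.

Lemma frac_class_eq p q :
  rf_num p * rf_den q - rf_num q * rf_den p = 0 -> frac_class p = frac_class q.
Proof. by move=> pq; apply/frac_classE; rewrite /frac_eq pq prime_ideal0. Qed.

Definition rf_zero := frac_class (to_frac 0).
Definition rf_one := frac_class (to_frac 1).

Local Ltac rf_ring :=
  rewrite /rf_zero /rf_one ?(rf_addE, rf_oppE, rf_mulE); apply: frac_class_eq;
  rewrite /frac_add /frac_opp /frac_mul /to_frac /mk_rf_frac /rf_num /rf_den /=; ring.

Lemma rf_addA : associative rf_add.
Proof.
by elim/frac_classW => p; elim/frac_classW => q; elim/frac_classW => r; rf_ring.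
Qed.
Lemma rf_addC : commutative rf_add.
Proof. by elim/frac_classW => p; elim/frac_classW => q; rf_ring. Qed.
Lemma rf_add0 : left_id rf_zero rf_add.
Proof. by elim/frac_classW => p; rf_ring. Qed.
Lemma rf_addN : left_inverse rf_zero rf_opp rf_add.
Proof. by elim/frac_classW => p; rf_ring. Qed.

HB.instance Definition _ :=
  GRing.isZmodule.Build residue_field rf_addA rf_addC rf_add0 rf_addN.

Lemma rf_mulA : associative rf_mul.
Proof.
by elim/frac_classW => p; elim/frac_classW => q; elim/frac_classW => r; rf_ring.
Qed.
Lemma rf_mulC : commutative rf_mul.
Proof. by elim/frac_classW => p; elim/frac_classW => q; rf_ring. Qed.
Lemma rf_mul1 : left_id rf_one rf_mul.
Proof. by elim/frac_classW => p; rf_ring. Qed.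
Lemma rf_mulDl : left_distributive rf_mul rf_add.
Proof.
by elim/frac_classW => p; elim/frac_classW => q; elim/frac_classW => r; rf_ring.
Qed.
Lemma rf_one_neq0 : rf_one != 0.
Proof.
apply/eqP => /frac_classE; rewrite /frac_eq /to_frac /mk_rf_frac /rf_num /rf_den /=.
by rewrite mulr1 mul0r subr0; apply/negP/prime_ideal1.
Qed.

HB.instance Definition _ := GRing.Zmodule_isComNzRing.Build residue_field
  rf_mulA rf_mulC rf_mul1 rf_mulDl rf_one_neq0.

Lemma frac_class0 p : (frac_class p == 0) = (rf_num p \in prime_ideal x).
Proof.
have E : frac_eq p (to_frac 0) = (rf_num p \in prime_ideal x).
  by rewrite /frac_eq /to_frac /mk_rf_frac /= {2}/rf_den {2}/rf_num /= mulr1 mul0r subr0.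
by rewrite -E; apply/eqP/idP => [/frac_classE|/frac_classE].
Qed.

Lemma rf_mulV u : u != 0 -> rf_mul (rf_inv u) u = 1.
Proof.
rewrite -{1}[u]frac_classK frac_class0 /rf_inv => nu.
case: {-}_ / boolP => [nz|]; last by rewrite nu.
by rewrite -[X in rf_mul _ X]frac_classK; rf_ring.
Qed.

Lemma rf_inv0 : rf_inv 0 = 0.
Proof.
rewrite /rf_inv; case: {-}_ / boolP => [nz|//].
by case/negP: nz; rewrite -frac_class0 frac_classK.
Qed.

HB.instance Definition _ :=
  GRing.ComNzRing_isField.Build residue_field rf_mulV rf_inv0.

Definition to_residue (a : R) : residue_field := frac_class (to_frac a).

Lemma to_residue_zmod : zmod_morphism to_residue.
Proof.
move=> a b; change (to_residue (a - b) =
  rf_add (frac_class (to_frac a)) (rf_opp (frac_class (to_frac b)))).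
by rewrite /to_residue; rf_ring.
Qed.

Lemma to_residue_monoid : monoid_morphism to_residue.
Proof.
split=> // a b; change (to_residue (a * b) =
  rf_mul (frac_class (to_frac a)) (frac_class (to_frac b))).
by rewrite /to_residue; rf_ring.
Qed.

HB.instance Definition _ :=
  GRing.isZmodMorphism.Build R residue_field to_residue to_residue_zmod.
HB.instance Definition _ :=
  GRing.isMonoidMorphism.Build R residue_field to_residue to_residue_monoid.

End ResidueField.

Record algebraic_closure (k : fieldType) := AlgebraicClosure {
  closure_field :> fieldType;
  closure_embed : {rmorphism k -> closure_field};
  closure_closed : GRing.closed_field_axiom closure_field;
  closure_algebraic : forall z : closure_field, algebraicOver closure_embed z }.

Section RadRing.
Variables (R : comPzRingType).
Variable kbar : forall x : spec R, algebraic_closure (residue_field x).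

Definition rad_ring : Type := forall x : spec R, kbar x.
Implicit Types u v w : rad_ring.

HB.instance Definition _ := gen_eqMixin rad_ring.
HB.instance Definition _ := gen_choiceMixin rad_ring.

Definition rad_zero : rad_ring := fun=> 0.
Definition rad_one : rad_ring := fun=> 1.
Definition rad_opp u : rad_ring := fun x => - u x.
Definition rad_add u v : rad_ring := fun x => u x + v x.
Definition rad_mul u v : rad_ring := fun x => u x * v x.

Lemma rad_addA : associative rad_add.
Proof. by move=> u v w; apply: functional_extensionality_dep => x; apply: addrA. Qed.
Lemma rad_addC : commutative rad_add.
Proof. by move=> u v; apply: functional_extensionality_dep => x; apply: addrC. Qed.
Lemma rad_add0 : left_id rad_zero rad_add.
Proof. by move=> u; apply: functional_extensionality_dep => x; apply: add0r. Qed.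
Lemma rad_addN : left_inverse rad_zero rad_opp rad_add.
Proof. by move=> u; apply: functional_extensionality_dep => x; apply: addNr. Qed.

HB.instance Definition _ :=
  GRing.isZmodule.Build rad_ring rad_addA rad_addC rad_add0 rad_addN.

Lemma rad_mulA : associative rad_mul.
Proof. by move=> u v w; apply: functional_extensionality_dep => x; apply: mulrA. Qed.
Lemma rad_mulC : commutative rad_mul.
Proof. by move=> u v; apply: functional_extensionality_dep => x; apply: mulrC. Qed.
Lemma rad_mul1 : left_id rad_one rad_mul.
Proof. by move=> u; apply: functional_extensionality_dep => x; apply: mul1r. Qed.
Lemma rad_mulDl : left_distributive rad_mul rad_add.
Proof. by move=> u v w; apply: functional_extensionality_dep => x; apply: mulrDl. Qed.

HB.instance Definition _ := GRing.Zmodule_isComPzRing.Build rad_ring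
  rad_mulA rad_mulC rad_mul1 rad_mulDl.

Definition to_rad (a : R) : rad_ring :=
  fun x => closure_embed (kbar x) (to_residue x a).

Lemma to_rad_zmod : zmod_morphism to_rad.
Proof.
by move=> a b; apply: functional_extensionality_dep => x; rewrite /to_rad !rmorphB.
Qed.

Lemma to_rad_monoid : monoid_morphism to_rad.
Proof.
split=> [|a b]; apply: functional_extensionality_dep => x; rewrite /to_rad.
  by rewrite !rmorph1.
by rewrite !rmorphM.
Qed.

HB.instance Definition _ := GRing.isZmodMorphism.Build R rad_ring to_rad to_rad_zmod.
HB.instance Definition _ :=
  GRing.isMonoidMorphism.Build R rad_ring to_rad to_rad_monoid.

End RadRing.

(* An affine X-scheme Spec A is represented by the R-algebra A, so a morphism
   Spec B -> Spec A is an element of [hom A B] and presheaves are covariant in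
   the algebra. *)

Inductive algebra_class := AllAlgebras | FiniteTypeAlgebras.

Definition in_class (c : algebra_class) (R A : comPzRingType)
    (f : {rmorphism R -> A}) : Prop :=
  if c is FiniteTypeAlgebras then finite_type f else True.

Section Site.
Variables (R : comPzRingType) (c : algebra_class).

Record obj := Obj {
  obj_ring :> comPzRingType;
  obj_str : {rmorphism R -> obj_ring};
  obj_class : in_class c obj_str }.

Record hom (A B : obj) := Hom {
  hom_fun :> {rmorphism A -> B};
  hom_str : forall r, hom_fun (obj_str A r) = obj_str B r }.

Lemma hom_ext (A B : obj) (f g : hom A B) : (forall a, f a = g a) -> f = g.
Proof.
case: f g => [f fP] [g gP] /= /funext fg.
suff E : f = g by case: _ / E gP => gP; congr Hom; apply: Prop_irrelevance.
case: f g fg {fP gP} => [f [[[f0 fD]] [[f1 fM]]]] [g [[[g0 gD]] [[g1 gM]]]] /= fg.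
move: f0 fD f1 fM; rewrite fg => f0 fD f1 fM.
by rewrite (Prop_irrelevance f0 g0) (Prop_irrelevance fD gD)
           (Prop_irrelevance f1 g1) (Prop_irrelevance fM gM).
Qed.

Definition hom_id (A : obj) : hom A A := @Hom A A idfun (fun=> erefl).

Lemma hom_comp_str (A B C : obj) (g : hom B C) (f : hom A B) r :
  (g \o f) (obj_str A r) = obj_str C r.
Proof. by rewrite /= !hom_str. Qed.

Definition hom_comp (A B C : obj) (g : hom B C) (f : hom A B) : hom A C :=
  @Hom A C (g \o f) (hom_comp_str g f).

Definition covering (A B : obj) (f : hom A B) : Prop :=
  finite_type f /\ spec_surjective f.

Lemma hom_id_covering (A : obj) : covering (hom_id A).
Proof.
split; last by move=> p; exists p.
by exists [::] => P _ AP _ a; apply: AP.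
Qed.

Record presheaf := Presheaf {
  psh :> obj -> zmodType;
  psh_res : forall A B, hom A B -> {additive psh A -> psh B};
  psh_res_id : forall A s, psh_res (hom_id A) s = s;
  psh_res_comp : forall A B C (g : hom B C) (f : hom A B) s,
    psh_res (hom_comp g f) s = psh_res g (psh_res f s) }.

Record psh_morphism (F G : presheaf) := PshMorphism {
  psh_map :> forall A, {additive F A -> G A};
  psh_natural : forall A B (f : hom A B) s,
    psh_map B (psh_res F f s) = psh_res G f (psh_map A s) }.

(* The sheafification of F.  A section over A is given by s in F(B) for a covering
   Spec B -> Spec A, such that the pullbacks of s along any two A-morphisms
   B -> C coincide on some covering of Spec C (they need not be equal, as F is
   not assumed separated).  Sections are identified, by [sec_eq] below, when
   they agree on a common refinement of their coverings. *)

Definition locally_eq (F : presheaf) (A : obj) (s t : F A) : Prop :=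
  exists (B : obj) (f : hom A B), covering f /\ psh_res F f s = psh_res F f t.

Record sheaf_section (F : presheaf) (A : obj) := SheafSection {
  sec_cover : obj;
  sec_map : hom A sec_cover;
  sec_covering : covering sec_map;
  sec_val : F sec_cover;
  sec_matching : forall (C : obj) (a b : hom sec_cover C),
    hom_comp a sec_map = hom_comp b sec_map ->
    locally_eq (psh_res F a sec_val) (psh_res F b sec_val) }.

(* t is the restriction of s along Spec A' -> Spec A. *)
Definition sec_restricts (F : presheaf) (A A' : obj) (g : hom A A')
    (s : sheaf_section F A) (t : sheaf_section F A') : Prop :=
  exists (B : obj) (f : hom A' B) (a : hom (sec_cover s) B)
         (b : hom (sec_cover t) B),
    [/\ covering f, hom_comp a (sec_map s) = hom_comp f g,
        hom_comp b (sec_map t) = f &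
        psh_res F a (sec_val s) = psh_res F b (sec_val t)].

Definition sec_eq (F : presheaf) (A : obj) (s t : sheaf_section F A) : Prop :=
  sec_restricts (hom_id A) s t.

Lemma locally_eq_refl (F : presheaf) (A : obj) (s : F A) : locally_eq s s.
Proof. by exists A, (hom_id A); split; first exact: hom_id_covering. Qed.

Lemma sheafify_unit_matching (F : presheaf) (A : obj) (s : F A)
    (C : obj) (a b : hom A C) :
  hom_comp a (hom_id A) = hom_comp b (hom_id A) ->
  locally_eq (psh_res F a s) (psh_res F b s).
Proof.
move=> ab; have -> : a = b.
  by apply: hom_ext => x; have := congr1 (fun h : hom A C => h x) ab.
exact: locally_eq_refl.
Qed.

Definition sheafify_unit (F : presheaf) (A : obj) (s : F A) : sheaf_section F A :=
  SheafSection (hom_id_covering A) (@sheafify_unit_matching F A s).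

Lemma sec_push_matching (F G : presheaf) (h : psh_morphism F G) (A : obj)
    (s : sheaf_section F A) (C : obj) (a b : hom (sec_cover s) C) :
  hom_comp a (sec_map s) = hom_comp b (sec_map s) ->
  locally_eq (psh_res G a (h _ (sec_val s))) (psh_res G b (h _ (sec_val s))).
Proof.
move=> /sec_matching[B [f [fc E]]]; exists B, f; split=> //.
by rewrite -!psh_natural E.
Qed.

Definition sec_push (F G : presheaf) (h : psh_morphism F G) (A : obj)
    (s : sheaf_section F A) : sheaf_section G A :=
  SheafSection (sec_covering s) (@sec_push_matching F G h A s).

Definition sheaf_exact (F G H : presheaf) (f : psh_morphism F G)
    (g : psh_morphism G H) : Prop :=
  forall (A : obj) (s : sheaf_section G A),
    sec_eq (sec_push g s) (sheafify_unit 0) ->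
    exists (B : obj) (u : hom A B),
      covering u /\
      exists t : sheaf_section F B, sec_restricts u s (sec_push f t).

Definition sections_exact (F G H : presheaf) (f : psh_morphism F G)
    (g : psh_morphism G H) (A : obj) : Prop :=
  forall s : sheaf_section G A,
    sec_eq (sec_push g s) (sheafify_unit 0) <->
    exists t : sheaf_section F A, sec_eq (sec_push f t) s.

Section ModulePresheaf.
Variable M : lmodType R.

Definition mod_sec (A : obj) : zmodType := base_change (obj_str A) M.

Definition mod_res (A B : obj) (f : hom A B) : {additive mod_sec A -> mod_sec B} :=
  bc_res (M := M) (@hom_str A B f).

Lemma mod_res_id A s : mod_res (hom_id A) s = s.
Proof.
elim/base_change_ind: s => [|m a s IH]; first exact: raddf0.
by rewrite raddfD IH /= bc_res_pure.
Qed.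

Lemma mod_res_comp A B C (g : hom B C) (f : hom A B) s :
  mod_res (hom_comp g f) s = mod_res g (mod_res f s).
Proof.
elim/base_change_ind: s => [|m a s IH]; first by rewrite !raddf0.
by rewrite !raddfD IH /= !bc_res_pure.
Qed.

Definition mod_presheaf : presheaf := Presheaf mod_res_id mod_res_comp.
End ModulePresheaf.

Section ModulePresheafMap.
Variables (M M' : lmodType R) (f : {linear M -> M'}).

Definition mod_map (A : obj) : {additive mod_presheaf M A -> mod_presheaf M' A} :=
  bc_map (obj_str A) f.

Lemma mod_map_natural A B (u : hom A B) (s : mod_presheaf M A) :
  mod_map B (psh_res (mod_presheaf M) u s)
  = psh_res (mod_presheaf M') u (mod_map A s).
Proof.
elim/base_change_ind: s => [|m a s IH]; first by rewrite !raddf0.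
by rewrite !raddfD IH /= bc_res_pure !bc_map_pure bc_res_pure.
Qed.

Definition mod_morphism : psh_morphism (mod_presheaf M) (mod_presheaf M') :=
  PshMorphism mod_map_natural.
End ModulePresheafMap.

End Site.

(* Main.v *)
(* Choose generators of M and L.  Then exactness after R -> S says that a row over S
   which beta sends into the S-span of the relations of L lies in the S-span of the
   rows over R representing elements of the image of alpha.

   If T is von Neumann regular, a row lies in such a span as soon as it does over
   all residue fields of T.  So exactness over fields implies exactness over products
   of fields.  This gives (iii), and also (i): solve the linear system over the
   product of the residue fields of an algebra A; the finitely many coefficients of
   the solution generate over A a subalgebra of that product, and this subalgebra is
   a covering of A.

   For (v), let s be a section of M over A, given on a covering D, and embed the
   image of A in W, the product of the residue fields of D, into its closure T in W
   under quasi-inverses.  T is regular and A -> T is an epimorphism of rings.  In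
   characteristic 0 residue fields are perfect, so by the matching condition s comes
   from a row over each residue field of T, and hence over T.  Over T the system is
   solvable; the solution involves finitely many quasi-inverses, and these generate
   a covering S of A.  Since A -> S is an epimorphism, every element of the tensor
   product of N with S satisfies the matching condition. *)
From HB Require Import structures.
From mathcomp Require Import all_boot all_algebra boolp classical_sets ring.
Require Import Defs.

Set Implicit Arguments.
Unset Strict Implicit.
Unset Printing Implicit Defensive.

Import GRing.Theory.
Local Open Scope ring_scope.
Local Open Scope quotient_scope.

(** * Spans of rows and base change *)

Lemma map_mx_factor (R S T : comPzRingType) (phi : R -> S) (psi : R -> T)
    (h : S -> T) m n (U : 'M[R]_(m, n)) :
  (forall r, h (phi r) = psi r) -> map_mx psi U = map_mx h (map_mx phi U).
Proof. by move=> hP; rewrite -map_mx_comp; apply: eq_map_mx => r /=. Qed.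

Section Span.
Variables (R : comPzRingType) (n : nat) (P : 'rV[R]_n -> Prop).

(** A combination is stored as a coefficient row times a matrix over [R], so that a further base
    change only acts on the coefficients and the finiteness of the data is explicit. Taking [phi] as
    a bare function allows pointwise equal maps to be exchanged. *)
Definition row_span (S : comPzRingType) (phi : R -> S) (s : 'rV[S]_n) : Prop :=
  exists k (t : 'rV[S]_k) (U : 'M[R]_(k, n)),
    (forall i, P (row i U)) /\ s = t *m map_mx phi U.

Section OneRing.
Variables (S : comPzRingType) (phi : {rmorphism R -> S}).

Lemma row_span0 : row_span phi 0.
Proof.
by exists 0%N, 0, 0; split; [case | rewrite mul0mx].
Qed.

Lemma row_spanD u v : row_span phi u -> row_span phi v -> row_span phi (u + v).
Proof.
move=> [k [t [U [PU ->]]]] [l [w [V [PV ->]]]].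
exists (k + l)%N, (row_mx t w), (col_mx U V).
split; last by rewrite map_col_mx mul_row_col.
by move=> i; case: (split_ordP i) => j ->; rewrite ?rowKu ?rowKd.
Qed.

Lemma row_spanZ a u : row_span phi u -> row_span phi (a *: u).
Proof.
move=> [k [t [U [PU ->]]]]; exists k, (a *: t), U; split=> //.
by rewrite scalemxAl.
Qed.

Lemma row_spanN u : row_span phi u -> row_span phi (- u).
Proof. by rewrite -scaleN1r; apply: row_spanZ. Qed.

Lemma row_spanB u v : row_span phi u -> row_span phi v -> row_span phi (u - v).
Proof. by move=> Pu /row_spanN; apply: row_spanD. Qed.

Lemma row_span_gen r : P r -> row_span phi (map_mx phi r).
Proof.
move=> Pr; exists 1%N, 1%:M, r; split; last by rewrite mul1mx.
by move=> i; rewrite (_ : row i r = r) //; apply/rowP => j; rewrite !mxE [i]ord1.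
Qed.

End OneRing.

Lemma row_span_map (S T : comPzRingType) (phi : {rmorphism R -> S})
    (psi : {rmorphism R -> T}) (h : {rmorphism S -> T}) s :
  (forall r, h (phi r) = psi r) -> row_span phi s -> row_span psi (map_mx h s).
Proof.
move=> hP [k [t [U [PU ->]]]]; exists k, (map_mx h t), U; split=> //.
by rewrite map_mxM -(map_mx_factor U hP).
Qed.

End Span.

Lemma row_span_ext (R S : comPzRingType) (phi psi : R -> S) n (P : 'rV[R]_n -> Prop) s :
  (forall r, phi r = psi r) -> row_span P phi s -> row_span P psi s.
Proof. by move/funext->. Qed.

Lemma row_span_mono (R S : comPzRingType) (phi : R -> S) n
    (P P' : 'rV[R]_n -> Prop) s :
  (forall r, P r -> P' r) -> row_span P phi s -> row_span P' phi s.
Proof.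
by move=> PP' [k [t [U [PU ->]]]]; exists k, t, U; split=> // i; apply: PP'.
Qed.

Lemma row_span_sum (R S : comPzRingType) (phi : {rmorphism R -> S}) n
    (P : 'rV[R]_n -> Prop) (I : finType) (F : I -> 'rV[S]_n) :
  (forall i, row_span P phi (F i)) -> row_span P phi (\sum_i F i).
Proof.
move=> PF; apply: big_ind => [||i _]; [exact: row_span0 | | exact: PF].
by move=> u v; apply: row_spanD.
Qed.

(** Combinations of combinations are combinations. This serves for the radical, where a submodule
    given by rows over [S] is extended to fields. *)
Lemma row_span_trans (R S T : comPzRingType) (phi : {rmorphism R -> S})
    (k : {rmorphism S -> T}) n (P : 'rV[R]_n -> Prop) (v : 'rV[T]_n) :
  row_span (row_span P phi) k v <-> row_span P (k \o phi) v.
Proof.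
split=> [[j [t [U [PU ->]]]]|[j [t [U [PU ->]]]]].
  rewrite mulmx_sum_row; apply: row_span_sum => i; apply: row_spanZ.
  by rewrite -map_row; apply: row_span_map (PU i).
exists j, t, (map_mx phi U); split; last by rewrite -(@map_mx_factor _ _ _ phi (k \o phi)).
by move=> i; rewrite -map_row; apply: row_span_gen.
Qed.

Lemma row_span_iff (R S : comPzRingType) (phi : R -> S) n (P P' : 'rV[R]_n -> Prop) s :
  (forall r, P r <-> P' r) -> row_span P phi s <-> row_span P' phi s.
Proof. by move=> PP'; split; apply: row_span_mono => r /PP'. Qed.

Section SpanQuotient.
Variables (R S : comPzRingType) (phi : {rmorphism R -> S}) (n : nat).
Variable P : 'rV[R]_n -> Prop.

Definition span_pred : {pred 'rV[S]_n} := fun s => `[< row_span P phi s >].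

Lemma span_predP : zmod_closed span_pred.
Proof.
split=> [|u v /asboolP Pu /asboolP Pv]; apply/asboolP; first exact: row_span0.
exact: row_spanB.
Qed.

HB.instance Definition _ :=
  GRing.isZmodClosed.Build 'rV[S]_n span_pred span_predP.

(** For [P := image_row f] with respect to generators of [M], this is the base change of the
    cokernel of [f], written in coordinates. *)
Definition span_quot : zmodType := Quotient.quot span_pred.

Lemma pi_span_quot_eq0 s : (\pi_span_quot s == 0 :> span_quot) <-> row_span P phi s.
Proof.
have -> : (0 : span_quot) = \pi_span_quot 0 by rewrite piE.
rewrite -Quotient.idealrBE subr0; split=> [/asboolP //|Ps]; exact/asboolP.
Qed.

End SpanQuotient.

Section PureTensors.
Variables (R S : comPzRingType) (phi : {rmorphism R -> S}) (M : lmodType R).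

Lemma pureDl (m m' : M) s : pure phi (m + m') s = pure phi m s + pure phi m' s.
Proof. by case: (pure_balanced phi M). Qed.
Lemma pureDr (m : M) s s' : pure phi m (s + s') = pure phi m s + pure phi m s'.
Proof. by case: (pure_balanced phi M). Qed.
Lemma pureZl a (m : M) s : pure phi (a *: m) s = pure phi m (phi a * s).
Proof. by case: (pure_balanced phi M). Qed.
Lemma pure0l s : pure phi (0 : M) s = 0.
Proof. exact: (balanced0l (pure_balanced phi M)). Qed.
Lemma pure0r (m : M) : pure phi m 0 = 0.
Proof. by rewrite -[X in pure _ _ X](mul0r 0) -(scale_pure phi) scale0r. Qed.
Lemma pureNr (m : M) s : pure phi m (- s) = - pure phi m s.
Proof. by apply: (addrI (pure phi m s)); rewrite -pureDr !subrr pure0r. Qed.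
Lemma pure_suml (I : finType) (F : I -> M) s :
  pure phi (\sum_i F i) s = \sum_i pure phi (F i) s.
Proof. exact: (big_morph (fun m : M => pure phi m s) (fun m m' => pureDl m m' s) (pure0l s)). Qed.

End PureTensors.

Section Generators.
Variables (R : comPzRingType) (M : lmodType R) (n : nat) (e : 'I_n -> M).

Definition lincomb (r : 'rV[R]_n) : M := \sum_i r 0 i *: e i.

Definition generating : Prop := forall m, exists r, m = lincomb r.

Lemma lincombD r r' : lincomb (r + r') = lincomb r + lincomb r'.
Proof. by rewrite -big_split; apply: eq_bigr => i _; rewrite mxE scalerDl. Qed.
Lemma lincombZ a r : lincomb (a *: r) = a *: lincomb r.
Proof. by rewrite scaler_sumr; apply: eq_bigr => i _; rewrite mxE scalerA. Qed.
Lemma lincombB r r' : lincomb (r - r') = lincomb r - lincomb r'.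
Proof. by rewrite -[- r']scaleN1r lincombD lincombZ scaleN1r. Qed.

(* For f = 0 these are the relations between the e i. *)
Definition image_row (N : lmodType R) (f : {linear N -> M}) (r : 'rV[R]_n) : Prop :=
  exists x, f x = lincomb r.

Variables (S : comPzRingType) (phi : {rmorphism R -> S}).

Definition bc_comb (s : 'rV[S]_n) : base_change phi M :=
  \sum_i pure phi (e i) (s 0 i).

Lemma bc_comb_is_zmod_morphism : zmod_morphism bc_comb.
Proof.
move=> s t; rewrite /bc_comb -sumrB; apply: eq_bigr => i _.
by rewrite !mxE pureDr pureNr.
Qed.
HB.instance Definition _ :=
  GRing.isZmodMorphism.Build 'rV[S]_n (base_change phi M) bc_comb
    bc_comb_is_zmod_morphism.

Lemma bc_comb_map r s : bc_comb (s *: map_mx phi r) = pure phi (lincomb r) s.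
Proof.
rewrite pure_suml; apply: eq_bigr => i _.
by rewrite !mxE pureZl mulrC.
Qed.

Lemma bc_comb_mul k (t : 'rV[S]_k) (U : 'M[R]_(k, n)) :
  bc_comb (t *m map_mx phi U) = \sum_i pure phi (lincomb (row i U)) (t 0 i).
Proof.
rewrite mulmx_sum_row raddf_sum; apply: eq_bigr => i _.
by rewrite -map_row /= bc_comb_map.
Qed.

Hypothesis eG : generating.

Lemma bc_comb_surj x : exists s, x = bc_comb s.
Proof.
elim/base_change_ind: x => [|m s x [t ->]]; first by exists 0; rewrite raddf0.
have [r ->] := eG m; exists (s *: map_mx phi r + t).
by rewrite raddfD /= bc_comb_map.
Qed.

Variables (N : lmodType R) (f : {linear N -> M}).

Lemma row_span_bc_comb s : row_span (image_row f) phi s -> exists y, bc_map phi f y = bc_comb s.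
Proof.
move=> [k [t [U [PU ->]]]].
have [x xE] : exists x : 'I_k -> N, forall i, f (x i) = lincomb (row i U).
  by exists (fun i => sval (cid (PU i))) => i; case: cid.
exists (\sum_i pure phi (x i) (t 0 i)); rewrite raddf_sum bc_comb_mul.
by apply: eq_bigr => i _; rewrite /= bc_map_pure xE.
Qed.

Let Q := span_quot phi (image_row f).

Definition coord_row (m : M) : 'rV[R]_n := sval (cid (eG m)).
Lemma coord_rowK m : lincomb (coord_row m) = m.
Proof. by rewrite /coord_row; case: cid. Qed.

(** The chosen coordinates are not additive in [m], but two choices of coordinates differ by a
    relation between the generators, which vanishes in [Q]. So the class is balanced although
    [coord_row] is not linear. *)
Definition coord_class (m : M) (s : S) : Q :=
  \pi_Q (s *: map_mx phi (coord_row m)).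

Lemma image_row0 r : lincomb r = 0 -> image_row f r.
Proof. by move=> r0; exists 0; rewrite linear0. Qed.

Lemma coord_class_eq m s r : lincomb r = m ->
  coord_class m s = \pi_Q (s *: map_mx phi r).
Proof.
move=> rm; apply/eqP; rewrite /coord_class -Quotient.idealrBE; apply/asboolP.
rewrite -scalerBr -map_mxB; apply/row_spanZ/row_span_gen/image_row0.
by rewrite lincombB coord_rowK rm subrr.
Qed.

Lemma coord_class_balanced : balanced phi coord_class.
Proof.
split=> [m m' s|m s s'|a m s].
- rewrite (@coord_class_eq _ s (coord_row m + coord_row m')); last first.
    by rewrite lincombD !coord_rowK.
  by rewrite map_mxD scalerDr piE.
- by rewrite /coord_class scalerDl piE.
- rewrite (@coord_class_eq _ s (a *: coord_row m)); last first.
    by rewrite lincombZ coord_rowK.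
  by rewrite map_mxZ scalerA mulrC.
Qed.

Let coord_value : base_change phi M -> Q := tensor_value coord_class.

Lemma coord_valueD x y : coord_value (x + y) = coord_value x + coord_value y.
Proof. exact: (tensor_valueD coord_class_balanced). Qed.

Lemma coord_value0 : coord_value 0 = 0.
Proof. exact: (tensor_value0 coord_class_balanced). Qed.

Lemma coord_class_comb s : coord_value (bc_comb s) = \pi_Q s.
Proof.
rewrite /bc_comb (big_morph _ coord_valueD coord_value0).
under eq_bigr => i _.
  rewrite /coord_value (tensor_value_pure _ _ coord_class_balanced).
  rewrite (@coord_class_eq _ _ (delta_mx 0 i)); last first.
    rewrite /lincomb (bigD1 i) //= big1 => [|j ji]; rewrite mxE ?eqxx ?scale1r ?addr0 //.
    by rewrite (negPf ji) andbF scale0r.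
  over.
rewrite -raddf_sum [in RHS](row_sum_delta s); congr (\pi_Q _).
by apply: eq_bigr => i _; rewrite map_delta_mx.
Qed.

(** Right exactness of the tensor product in coordinates: the map induced by [coord_class] kills the
    image of [f] and sends [bc_comb s] to the class of [s]. *)
Lemma bc_comb_row_span s y :
  bc_map phi f y = bc_comb s -> row_span (image_row f) phi s.
Proof.
move=> ys; apply/pi_span_quot_eq0; rewrite -coord_class_comb -ys; apply/eqP.
elim/base_change_ind: y {ys} => [|x t y IH]; first by rewrite raddf0 coord_value0.
rewrite raddfD coord_valueD IH addr0 /= bc_map_pure.
rewrite /coord_value (tensor_value_pure _ _ coord_class_balanced).
apply/eqP/pi_span_quot_eq0/row_spanZ/row_span_gen.
by exists x; rewrite coord_rowK.
Qed.

Lemma bc_comb_imageP s :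
  (exists y, bc_map phi f y = bc_comb s) <-> row_span (image_row f) phi s.
Proof. by split=> [[y]|]; [apply: bc_comb_row_span | apply: row_span_bc_comb]. Qed.

End Generators.

Definition relation_row (R : comPzRingType) (M : lmodType R) n (e : 'I_n -> M)
  (r : 'rV[R]_n) : Prop := lincomb e r = 0.

Section Relations.
Variables (R : comPzRingType) (M : lmodType R) (n : nat) (e : 'I_n -> M).
Variables (S : comPzRingType) (phi : {rmorphism R -> S}).

(** An element is zero iff it lies in the image of the zero map, so this is the case [f = 0] of
    [bc_comb_imageP]. *)
Lemma bc_comb_eq0 (s : 'rV[S]_n) : generating e ->
  bc_comb e phi s = 0 <-> row_span (relation_row e) phi s.
Proof.
move=> eG; have imE r : image_row e (\0 : {linear M -> M}) r <-> relation_row e r.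
  by split=> [[x rx]|r0]; [rewrite /relation_row -rx | exists 0; rewrite r0].
split=> [s0|/(row_span_mono (fun r => proj2 (imE r)))].
  apply: (row_span_mono (fun r => proj1 (imE r))); apply/bc_comb_imageP => //.
  by exists 0; rewrite raddf0.
move=> /row_span_bc_comb[y <-].
elim/base_change_ind: y => [|m t y IH]; first exact: raddf0.
by rewrite raddfD /= IH bc_map_pure pure0l addr0.
Qed.

End Relations.

Section ExactnessOnRows.
Variables (R : comPzRingType) (N M L : lmodType R).
Variables (alpha : {linear N -> M}) (beta : {linear M -> L}).
Variables (m l : nat) (e : 'I_m -> M) (f : 'I_l -> L) (B : 'M[R]_(m, l)).
Hypotheses (eG : generating e) (fG : generating f).
Hypothesis BE : forall i, beta (e i) = lincomb f (row i B).
Hypothesis alpha_beta : forall n, beta (alpha n) = 0.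

Definition row_exact (S : comPzRingType) (phi : R -> S) : Prop :=
  forall s : 'rV[S]_m, row_span (relation_row f) phi (s *m map_mx phi B) ->
    row_span (image_row e alpha) phi s.

Variables (S : comPzRingType) (phi : {rmorphism R -> S}).

Lemma bc_map_comb s :
  bc_map phi beta (bc_comb e phi s) = bc_comb f phi (s *m map_mx phi B).
Proof.
rewrite bc_comb_mul raddf_sum; apply: eq_bigr => i _ /=.
by rewrite bc_map_pure BE.
Qed.

Lemma bc_map_comp0 x : bc_map phi beta (bc_map phi alpha x) = 0.
Proof.
elim/base_change_ind: x => [|n s x IH]; first by rewrite !raddf0.
by rewrite !raddfD /= IH !bc_map_pure alpha_beta pure0l addr0.
Qed.

Lemma exact_afterE : exact_after phi alpha beta <-> row_exact phi.
Proof.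
split=> [ex s|ex x].
  move=> /(bc_comb_eq0 _ _ fG); rewrite -bc_map_comb => /ex[y yE].
  by apply/bc_comb_imageP => //; exists y.
split=> [|[y <-]]; last exact: bc_map_comp0.
have [s ->] := bc_comb_surj eG x.
rewrite bc_map_comb => /(bc_comb_eq0 _ _ fG)/ex.
exact: row_span_bc_comb.
Qed.

End ExactnessOnRows.

Section FieldExtension.
Variables (R : comPzRingType) (k K : fieldType).
Variables (phi : {rmorphism R -> k}) (psi : {rmorphism R -> K}).
Variable h : {rmorphism k -> K}.
Hypothesis hP : forall r, h (phi r) = psi r.

(** Ranks do not change under a field extension, so a linear system over [k] that is solvable over
    [K] is solvable over [k]. *)
Lemma row_span_descent n (P : 'rV[R]_n -> Prop) (s : 'rV[k]_n) :
  row_span P psi (map_mx h s) -> row_span P phi s.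
Proof.
move=> [j [t [U [PU sE]]]].
have : (map_mx h s <= map_mx h (map_mx phi U))%MS.
  by rewrite sE (map_mx_factor _ hP) submxMl.
by rewrite map_submx => /submxP[D ->]; exists j, D, U.
Qed.

Variables (N M L : lmodType R) (alpha : {linear N -> M}).
Variables (m l : nat) (e : 'I_m -> M) (f : 'I_l -> L) (B : 'M[R]_(m, l)).

(* A solution over K of s B = t V is a combination of a basis over k of the
   solution space. *)
Lemma row_exact_ext : row_exact alpha e f B phi -> row_exact alpha e f B psi.
Proof.
move=> ex s [j [t [V [PV sE]]]].
pose A := kermx (col_mx (map_mx phi B) (- map_mx phi V)).
have : (row_mx s t <= map_mx h A)%MS.
  rewrite map_kermx map_col_mx map_mxN -!(map_mx_factor _ hP).
  by apply/sub_kermxP; rewrite mul_row_col mulmxN sE subrr.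
case/submxP => X stE.
have -> : s = \sum_i X 0 i *: map_mx h (row i (lsubmx A)).
  rewrite -[s](row_mxKl s t) stE -[A]hsubmxK map_row_mx mul_mx_row !row_mxKl.
  by rewrite mulmx_sum_row; apply: eq_bigr => i _; rewrite map_row.
apply: row_span_sum => i; apply/row_spanZ/(row_span_map hP)/ex.
exists j, (row i (rsubmx A)), V; split=> //.
apply/eqP; rewrite -subr_eq0 -mulmxN -mul_row_col -row_row_mx hsubmxK.
by rewrite -row_mul mulmx_ker row0.
Qed.

End FieldExtension.

(** * Residue fields and prime ideals *)

Section Residue.
Variables (R : comPzRingType) (x : spec R).

Lemma to_residue_eq0 a : (to_residue x a == 0) = (a \in prime_ideal x).
Proof. by rewrite frac_class0. Qed.

Lemma residue_fraction (u : residue_field x) :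
  exists a b, b \notin prime_ideal x /\ u * to_residue x b = to_residue x a.
Proof.
elim/frac_classW: u => p; exists (rf_num p), (rf_den p); split; first exact: rf_denP.
change (rf_mul (frac_class p) (frac_class (to_frac x (rf_den p))) =
  frac_class (to_frac x (rf_num p))).
rewrite rf_mulE; apply: frac_class_eq.
by rewrite /frac_mul /to_frac /mk_rf_frac /rf_num /rf_den /=; ring.
Qed.

Variables (K : fieldType) (f : {rmorphism R -> K}).
Hypothesis fx : forall a, (f a == 0) = (a \in prime_ideal x).

(* The proof argument lets the morphism instances below be inferred. *)
Definition residue_lift of (forall a, (f a == 0) = (a \in prime_ideal x)) :
    residue_field x -> K :=
  fun u => f (rf_num (repr u)) / f (rf_den (repr u)).

Lemma residue_liftE u a b : b \notin prime_ideal x ->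
  u * to_residue x b = to_residue x a -> residue_lift fx u = f a / f b.
Proof.
move=> bx; rewrite /residue_lift; set p := repr u.
have -> : u = frac_class p by rewrite frac_classK.
change (rf_mul (frac_class p) (frac_class (to_frac x b)) = to_residue x a ->
  f (rf_num p) / f (rf_den p) = f a / f b).
rewrite rf_mulE.
move/frac_classE; rewrite /frac_eq /to_frac /frac_mul /mk_rf_frac /rf_num /rf_den /=.
rewrite mulr1 -fx rmorphB !rmorphM rmorph1 mulr1 subr_eq0 => /eqP E.
apply/eqP; rewrite eqr_div ?E ?fx ?(rf_denP p) //.
Qed.

Lemma residue_lift_residue a : residue_lift fx (to_residue x a) = f a.
Proof.
rewrite (@residue_liftE _ a 1) ?rmorph1 ?divr1 ?mulr1 //; exact: prime_ideal1.
Qed.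

Lemma residue_lift_zmod : zmod_morphism (residue_lift fx).
Proof.
move=> u v; have [a [b [bx ub]]] := residue_fraction u.
have [c [d [dx vd]]] := residue_fraction v.
rewrite (residue_liftE bx ub) (residue_liftE dx vd).
rewrite (@residue_liftE _ (a * d - c * b) (b * d)).
- have b0 : f b != 0 by rewrite fx.
  have d0 : f d != 0 by rewrite fx.
  by rewrite rmorphB !rmorphM; field; apply/andP; split.
- exact: prime_idealM.
- by rewrite rmorphB !rmorphM /= -ub -vd; ring.
Qed.

Lemma residue_lift_monoid : monoid_morphism (residue_lift fx).
Proof.
split=> [|u v].
  by rewrite -[X in _ X = _](rmorph1 (@to_residue _ x)) residue_lift_residue rmorph1.
have [a [b [bx ub]]] := residue_fraction u.
have [c [d [dx vd]]] := residue_fraction v.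
rewrite (residue_liftE bx ub) (residue_liftE dx vd).
rewrite (@residue_liftE _ (a * c) (b * d)).
- by rewrite !rmorphM mulf_div.
- exact: prime_idealM.
- by rewrite !rmorphM /= -ub -vd; ring.
Qed.

HB.instance Definition _ := GRing.isZmodMorphism.Build
  (residue_field x) K (residue_lift fx) residue_lift_zmod.
HB.instance Definition _ := GRing.isMonoidMorphism.Build
  (residue_field x) K (residue_lift fx) residue_lift_monoid.

End Residue.

Section Primes.
Variables (A B : comPzRingType) (f : {rmorphism A -> B}).

Lemma pull_prime (q : spec B) : is_prime (fun a => f a \in q).
Proof.
pose p : {pred A} := fun a => f a \in q.
have pE a : (a \in p) = (f a \in q) by [].
split=> [|| u v]; rewrite ?pE.
- split=> [|a u v]; rewrite ?pE ?rmorph0 ?prime_ideal0 //.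
  by move=> uq vq; rewrite rmorphD rmorphM prime_idealD // prime_idealMl.
- by rewrite rmorph1 prime_ideal1.
- by rewrite rmorphM; case: (prime_idealP q) => _ _; apply.
Qed.

Definition spec_pull (q : spec B) : spec A := Spec (pull_prime q).

Lemma spec_pullE q a : (a \in spec_pull q) = (f a \in q).
Proof. by []. Qed.

End Primes.

Lemma field_zero_prime (K : fieldType) : is_prime (fun a : K => a == 0).
Proof.
pose p : {pred K} := fun a => a == 0.
have pE a : (a \in p) = (a == 0) by [].
split=> [|| u v]; rewrite ?pE ?oner_eq0 //.
- split=> [|a u v]; rewrite ?pE ?eqxx // => /eqP-> /eqP->.
  by rewrite mulr0 addr0.
- by rewrite mulf_eq0 => /orP.
Qed.

Definition zero_prime (K : fieldType) : spec K := Spec (@field_zero_prime K).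

Definition kernel_prime (A : comPzRingType) (K : fieldType)
  (f : {rmorphism A -> K}) : spec A := spec_pull f (zero_prime K).

Lemma kernel_primeE (A : comPzRingType) (K : fieldType)
  (f : {rmorphism A -> K}) a : (f a == 0) = (a \in prime_ideal (kernel_prime f)).
Proof. by []. Qed.

(** Let [p] be the kernel of [h] and [q] a prime of [B] over [p]. The residue field of [p] embeds
    into that of [q] and into [K]; the relation descends along the first embedding and extends along
    the second. *)
Lemma row_span_surjective (R A B : comPzRingType) (g : {rmorphism A -> B})
    (phi : {rmorphism R -> A}) (psi : {rmorphism R -> B})
    n (P : 'rV[R]_n -> Prop) (s : 'rV[A]_n) :
    spec_surjective g -> (forall r, g (phi r) = psi r) ->
    row_span P psi (map_mx g s) ->
  forall (K : fieldType) (h : {rmorphism A -> K}) (chi : {rmorphism R -> K}),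
    (forall r, h (phi r) = chi r) -> row_span P chi (map_mx h s).
Proof.
move=> gs gP Ps K h chi hP.
have [q qE] := gs (kernel_prime h).
pose p := kernel_prime h.
pose toq : {rmorphism B -> residue_field q} := @to_residue _ q.
have fq a : ((toq \o g) a == 0) = (a \in prime_ideal p).
  by rewrite to_residue_eq0 -[RHS]qE.
pose i : {rmorphism residue_field p -> residue_field q} := residue_lift fq.
pose j : {rmorphism residue_field p -> K} := residue_lift (@kernel_primeE _ _ h).
pose top : {rmorphism A -> residue_field p} := @to_residue _ p.
have ps : row_span P (top \o phi) (map_mx top s).
  have iP r : i ((top \o phi) r) = (toq \o psi) r.
    by rewrite /= residue_lift_residue /= gP.
  apply: (row_span_descent iP); rewrite -map_mx_comp.
  have -> : map_mx (i \o top) s = map_mx toq (map_mx g s).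
    by rewrite -map_mx_comp; apply: eq_map_mx => a /=; rewrite residue_lift_residue.
  exact: row_span_map Ps.
have -> : map_mx h s = map_mx j (map_mx top s).
  by rewrite -map_mx_comp; apply: eq_map_mx => a /=; rewrite residue_lift_residue.
apply: row_span_map ps => r /=; by rewrite residue_lift_residue hP.
Qed.

(** * Maximal submodules and prime ideals disjoint from a multiplicative set *)

Section MaximalSubmodules.
Variables (R : comPzRingType) (M : lmodType R).

Definition is_submodule (N : M -> Prop) : Prop :=
  N 0 /\ forall a u v, N u -> N v -> N (a *: u + v).

(** Zorn's lemma for submodules that contain [N0] and miss [Z]. In a ring it produces prime ideals,
    in a vector space hyperplanes. *)
Lemma maximal_submodule (N0 Z : M -> Prop) :
    is_submodule N0 -> (forall u, N0 u -> ~ Z u) ->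
  exists N : M -> Prop, [/\ is_submodule N, forall u, N0 u -> N u,
    forall u, N u -> ~ Z u &
    forall v, ~ N v -> exists a u, N u /\ Z (a *: v + u)].
Proof.
move=> [N00 N0D] N0Z.
(* Joining [N0] makes the empty set admissible, which is the union of the empty chain. *)
pose ext (A : set M) (u : M) : Prop := N0 u \/ A u.
pose good : set (set M) := fun A => is_submodule (ext A) /\ forall u, A u -> ~ Z u.
have [|A [[[sA0 sAD] AZ] Amax]] := @Zorn_bigcup M good.
  move=> F Fgood Ftot; split; last by move=> u [X FX Xu]; apply: (Fgood X FX).2.
  have sub X a u v : F X -> ext X u -> ext X v ->
      ext (\bigcup_(Y in F) Y)%classic (a *: u + v).
    move=> FX Xu Xv; have [[_ /(_ a u v Xu Xv)[N0w|Xw]] _] := Fgood X FX;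
      by [left | right; exists X].
  split=> [|a u v [N0u|[X FX Xu]] [N0v|[Y FY Yv]]]; first by left.
  - by left; apply: N0D.
  - by apply: (sub Y) => //; [left | right].
  - by apply: (sub X) => //; [right | left].
  - by have [XY|YX] := Ftot X Y FX FY; [apply: (sub Y) | apply: (sub X)] => //;
       right => //; [apply: XY | apply: YX].
exists (ext A); split=> // [u Nu|u [/N0Z //|/AZ //]|v nv]; first by left.
apply: contrapT => noZ.
pose A' : set M := fun w => exists a u, ext A u /\ w = a *: v + u.
apply: (Amax A').
  split; last first.
    move=> /(_ v) vA; apply: nv; right; apply: vA.
    by exists 1, 0; split; [left | rewrite scale1r addr0].
  by move=> u Au; exists 0, u; rewrite scale0r add0r; split=> //; right.
have A'e u : ext A' u -> A' u.
  by case=> // N0u; exists 0, u; rewrite scale0r add0r; split=> //; left.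
split; last by move=> u [a [w [Aw ->]]] Zu; apply: noZ; exists a, w.
split=> [|a u w /A'e[b [u' [Au ->]]] /A'e[c [w' [Aw ->]]]]; first by left.
right; exists (a * b + c), (a *: u' + w'); split; first exact: sAD.
by rewrite scalerDr scalerA scalerDl addrACA.
Qed.

End MaximalSubmodules.

Section PrimeAvoidance.
Variable R : comPzRingType.

Definition is_idealp (I : R -> Prop) : Prop :=
  I 0 /\ forall a u v, I u -> I v -> I (a * u + v).

(** An ideal [N] maximal among those missing [Z] is prime: if [u] and [v] are outside [N], then [Z]
    contains some [a * u + i] and [b * v + j] with [i], [j] in [N], and their product would lie in
    [N] if [u * v] did. *)
Lemma prime_disjoint (I Z : R -> Prop) :
    is_idealp I -> Z 1 -> (forall u v, Z u -> Z v -> Z (u * v)) ->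
    (forall u, I u -> ~ Z u) ->
  exists p : spec R, (forall a, I a -> a \in prime_ideal p) /\
    forall a, Z a -> a \notin prime_ideal p.
Proof.
move=> II Z1 ZM IZ.
have [N [[N0 ND] IN NZ Nmax]] := @maximal_submodule R R^o I Z II IZ.
pose p : {pred R} := fun a => `[< N a >].
have pP (a : R) : reflect (N a) (a \in p) := asboolP (N a).
have primep : @is_prime R (fun a => `[< N a >]).
  split.
  - by split=> [|a u v /pP Nu /pP Nv]; apply/pP; last exact: ND.
  - by apply/pP => /NZ; apply.
  move=> u v /pP Nuv; have [Nu|/Nmax[a [i [Ni Zu]]]] := EM (N u).
    by left; apply/pP.
  have [Nv|/Nmax[b [j [Nj Zv]]]] := EM (N v); first by right; apply/pP.
  case: (NZ _ _ (ZM _ _ Zu Zv)).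
  have -> : ((a *: (u : R^o) + i) * (b *: (v : R^o) + j) : R) =
    (a * b) * (u * v) + ((a * u + i) * j + ((b * v) * i + 0)).
    by rewrite /GRing.scale /=; ring.
  by apply: (ND) => //; apply: (ND) => //; apply: (ND).
exists (@Spec R _ primep); split=> a ?; first by apply/pP/IN.
by apply/pP => /NZ; apply.
Qed.

Lemma prime_avoiding (I : R -> Prop) (z : R) :
    is_idealp I -> (forall n, ~ I (z ^+ n)) ->
  exists p : spec R, (forall a, I a -> a \in prime_ideal p) /\
    z \notin prime_ideal p.
Proof.
move=> II Iz.
have [||u Iu [n un]|p [Ip Zp]] :=
  @prime_disjoint I (fun u => exists n, u = z ^+ n) II.
- by exists 0%N.
- by move=> _ _ [n ->] [k ->]; exists (n + k)%N; rewrite exprD.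
- by apply: (Iz n); rewrite -un.
by exists p; split=> //; apply: Zp; exists 1%N.
Qed.

Lemma prime_containing (I : R -> Prop) : is_idealp I -> ~ I 1 ->
  exists p : spec R, forall a, I a -> a \in prime_ideal p.
Proof.
move=> II I1; have [n|p [Ip _]] := @prime_avoiding I 1 II; last by exists p.
by rewrite expr1n.
Qed.

End PrimeAvoidance.

(** * Von Neumann regular rings *)

(** The second equation makes the quasi-inverse unique; over a field it is the inverse of [u], or 0
    if [u = 0]. *)
Definition quasi_inverse (T : comPzRingType) (u v : T) : Prop :=
  u * v * u = u /\ v * u * v = v.

Definition regular_ring (T : comPzRingType) : Prop :=
  forall u : T, exists v, quasi_inverse u v.

Lemma quasi_inverse_uniq (T : comPzRingType) (u v w : T) :
  quasi_inverse u v -> quasi_inverse u w -> v = w.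
Proof.
have half a b : quasi_inverse u a -> quasi_inverse u b -> a = a * u * b.
  move=> [_ aua] [ubu _]; transitivity (a * (u * b * u) * a); first by rewrite ubu aua.
  by transitivity (a * u * a * u * b); [ring | rewrite aua].
by move=> uv uw; rewrite (half v w uv uw) [RHS](half w v uw uv); ring.
Qed.

Section RegularRings.
Variables (T : comPzRingType) (Treg : regular_ring T) (p : spec T).

(** A quasi-inverse of the denominator [b] becomes its inverse in the residue field, so the quotient
    of [T] by [p] is already a field. *)
Lemma regular_residue_surj (u : residue_field p) : exists a, u = to_residue p a.
Proof.
have [a [b [bp ub]]] := residue_fraction u; have [b' [bb _]] := Treg b.
exists (a * b'); rewrite rmorphM /= -ub -mulrA.
suff -> : to_residue p b * to_residue p b' = 1 by rewrite mulr1.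
have b0 : to_residue p b != 0 by rewrite to_residue_eq0.
by apply: (mulIf b0); rewrite mul1r -2!(rmorphM (@to_residue _ p)) bb.
Qed.

(** For [d 0 i] with quasi-inverse [d' i], the element [1 - d 0 i * d' i] kills [d 0 i] and is 1
    modulo [p]; [w] is the product of these. *)
Lemma regular_annihilator n (d : 'rV[T]_n) :
  (forall i, d 0 i \in prime_ideal p) ->
  exists w, w \notin prime_ideal p /\ w *: d = 0.
Proof.
move=> dp; have [d' dd'] := choice (fun i => Treg (d 0 i)).
exists (\prod_i (1 - d 0 i * d' i)); split.
  apply: (big_ind (fun w => w \notin prime_ideal p)) => [|u v|i _].
  - exact: prime_ideal1.
  - exact: prime_idealM.
  apply/negP => /prime_idealD/(_ (prime_idealMl (d' i) (dp i))).
  by rewrite mulrC subrK; apply/negP/prime_ideal1.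
apply/rowP => i; rewrite !mxE (bigD1 i) //= mulrAC mulrBl mul1r.
by case: (dd' i) => -> _; rewrite subrr mul0r.
Qed.

Variables (R : comPzRingType) (phi : {rmorphism R -> T}) (n : nat).
Variables (P : 'rV[R]_n -> Prop) (s : 'rV[T]_n).

(** The coefficients of a solution in the residue field lift to [T]. The error of the lifted
    solution has its finitely many entries in [p], so some [w] outside [p] kills it. *)
Lemma regular_row_span_nbhd :
    row_span P (@to_residue _ p \o phi) (map_mx (@to_residue _ p) s) ->
  exists w, w \notin prime_ideal p /\ row_span P phi (w *: s).
Proof.
move=> [k [t [U [PU sE]]]].
have [t' tE] := choice (fun i => regular_residue_surj (t 0 i)).
pose t1 : 'rV[T]_k := \row_i t' i.
have [i|w [wp wd]] := @regular_annihilator _ (s - t1 *m map_mx phi U).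
  rewrite -to_residue_eq0; have /rowP/(_ i) := sE; rewrite !mxE => E.
  rewrite rmorphB /= E subr_eq0 rmorph_sum; apply/eqP/eq_bigr => j _.
  by rewrite !mxE tE -rmorphM.
exists w; split=> //; exists k, (w *: t1), U; split=> //.
by apply/eqP; rewrite -scalemxAl -subr_eq0 -scalerBr wd.
Qed.

End RegularRings.

Lemma row_span_idealp (R S : comPzRingType) (phi : {rmorphism R -> S}) n
    (P : 'rV[R]_n -> Prop) (s : 'rV[S]_n) :
  is_idealp (fun a => row_span P phi (a *: s)).
Proof.
split=> [|a u v Pu Pv]; first by rewrite scale0r; apply: row_span0.
by rewrite scalerDl -scalerA; apply: row_spanD => //; apply: row_spanZ.
Qed.

(** The elements [a] for which [a *: s] lies in the span form an ideal, and by
    [regular_row_span_nbhd] no prime contains it. *)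
Lemma regular_row_span (R T : comPzRingType) (phi : {rmorphism R -> T}) n
    (P : 'rV[R]_n -> Prop) (s : 'rV[T]_n) :
    regular_ring T ->
    (forall p : spec T,
       row_span P (@to_residue _ p \o phi) (map_mx (@to_residue _ p) s)) ->
  row_span P phi s.
Proof.
move=> Treg Ps; apply: contrapT => nPs.
have [|p Ip] := prime_containing (row_span_idealp phi P s).
  by rewrite scale1r.
have [w [wp Pw]] := regular_row_span_nbhd Treg (Ps p).
by move: wp; rewrite Ip.
Qed.

(** * Products of fields *)

Section FieldProduct.
Variables (X : Type) (K : X -> fieldType).

Definition field_prod : Type := forall x, K x.
Implicit Types u v w : field_prod.

HB.instance Definition _ := gen_eqMixin field_prod.
HB.instance Definition _ := gen_choiceMixin field_prod.

Definition fp_zero : field_prod := fun=> 0.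
Definition fp_one : field_prod := fun=> 1.
Definition fp_opp u : field_prod := fun x => - u x.
Definition fp_add u v : field_prod := fun x => u x + v x.
Definition fp_mul u v : field_prod := fun x => u x * v x.

Lemma fp_addA : associative fp_add.
Proof. by move=> u v w; apply: functional_extensionality_dep => x; apply: addrA. Qed.
Lemma fp_addC : commutative fp_add.
Proof. by move=> u v; apply: functional_extensionality_dep => x; apply: addrC. Qed.
Lemma fp_add0 : left_id fp_zero fp_add.
Proof. by move=> u; apply: functional_extensionality_dep => x; apply: add0r. Qed.
Lemma fp_addN : left_inverse fp_zero fp_opp fp_add.
Proof. by move=> u; apply: functional_extensionality_dep => x; apply: addNr. Qed.

HB.instance Definition _ :=
  GRing.isZmodule.Build field_prod fp_addA fp_addC fp_add0 fp_addN.

Lemma fp_mulA : associative fp_mul.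
Proof. by move=> u v w; apply: functional_extensionality_dep => x; apply: mulrA. Qed.
Lemma fp_mulC : commutative fp_mul.
Proof. by move=> u v; apply: functional_extensionality_dep => x; apply: mulrC. Qed.
Lemma fp_mul1 : left_id fp_one fp_mul.
Proof. by move=> u; apply: functional_extensionality_dep => x; apply: mul1r. Qed.
Lemma fp_mulDl : left_distributive fp_mul fp_add.
Proof. by move=> u v w; apply: functional_extensionality_dep => x; apply: mulrDl. Qed.

HB.instance Definition _ := GRing.Zmodule_isComPzRing.Build field_prod
  fp_mulA fp_mulC fp_mul1 fp_mulDl.

Lemma field_quasi_inverse (F : fieldType) (a : F) : quasi_inverse a a^-1.
Proof.
have [->|a0] := eqVneq a 0; first by split; rewrite ?invr0 !mul0r.
by split; rewrite (mulfV, mulVf) ?mul1r.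
Qed.

Lemma field_prod_regular : regular_ring field_prod.
Proof.
move=> u; exists (fun x => (u x)^-1).
by split; apply: functional_extensionality_dep => x;
   case: (field_quasi_inverse (u x)).
Qed.

Definition fp_proj x u : K x := u x.

Lemma fp_proj_zmod x : zmod_morphism (@fp_proj x). Proof. by []. Qed.
Lemma fp_proj_monoid x : monoid_morphism (@fp_proj x). Proof. by []. Qed.

HB.instance Definition _ x :=
  GRing.isZmodMorphism.Build field_prod (K x) (@fp_proj x) (@fp_proj_zmod x).
HB.instance Definition _ x :=
  GRing.isMonoidMorphism.Build field_prod (K x) (@fp_proj x) (@fp_proj_monoid x).

End FieldProduct.

(** [rad_ring kbar] is, up to conversion, a product of fields. *)
Lemma rad_ring_regular (R : comPzRingType)
  (kbar : forall x : spec R, algebraic_closure (residue_field x)) :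
  regular_ring (rad_ring kbar).
Proof. exact: field_prod_regular. Qed.

Section ResidueProduct.
Variable B : comPzRingType.

Definition residue_prod : comPzRingType := field_prod (@residue_field B).

Definition to_prod (b : B) : residue_prod := fun q => to_residue q b.

Lemma to_prod_zmod : zmod_morphism to_prod.
Proof.
by move=> a b; apply: functional_extensionality_dep => q; rewrite /to_prod rmorphB.
Qed.
Lemma to_prod_monoid : monoid_morphism to_prod.
Proof.
split=> [|a b]; apply: functional_extensionality_dep => q; rewrite /to_prod.
  by rewrite rmorph1.
by rewrite rmorphM.
Qed.

HB.instance Definition _ :=
  GRing.isZmodMorphism.Build B residue_prod to_prod to_prod_zmod.
HB.instance Definition _ :=
  GRing.isMonoidMorphism.Build B residue_prod to_prod to_prod_monoid.

Lemma to_prod_surjective : spec_surjective to_prod.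
Proof.
move=> q; pose pr : {rmorphism residue_prod -> residue_field q} :=
  @fp_proj _ (@residue_field B) q.
by exists (kernel_prime pr) => b; rewrite -(kernel_primeE pr) to_residue_eq0.
Qed.

End ResidueProduct.

(** * Exactness over regular rings and over the product of algebraic closures *)

Section RowExactness.
Variables (R : comPzRingType) (N M L : lmodType R) (alpha : {linear N -> M}).
Variables (m l : nat) (e : 'I_m -> M) (f : 'I_l -> L) (B : 'M[R]_(m, l)).
Notation row_exact := (row_exact alpha e f B).

Definition row_exact_fields : Prop :=
  forall (K : fieldType) (k : {rmorphism R -> K}), row_exact k.

Lemma row_exact_regular (T : comPzRingType) (phi : {rmorphism R -> T}) :
  row_exact_fields -> regular_ring T -> row_exact phi.
Proof.
move=> ex Treg s sB; apply: regular_row_span => // p; apply: ex.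
rewrite (@map_mx_factor _ _ _ phi _ (@to_residue _ p)) // -map_mxM; exact: row_span_map sB.
Qed.

(* T is a direct factor of S with idempotent eps. *)
Lemma row_exact_factor (S T : comPzRingType) (phi : {rmorphism R -> S})
    (psi : {rmorphism R -> T}) (pr : {rmorphism S -> T}) (eps : S) :
    (forall r, pr (phi r) = psi r) -> (forall a, exists u, a = pr u) ->
    pr eps = 1 -> (forall u, pr u = 0 -> eps * u = 0) ->
  row_exact phi -> row_exact psi.
Proof.
move=> prP prS eps1 eps0 ex s [k [t [U [PU sE]]]].
have lift n (v : 'rV[T]_n) : exists w : 'rV[S]_n, v = map_mx pr w.
  have [w wE] := choice (fun i => prS (v 0 i)).
  by exists (\row_i w i); apply/rowP => i; rewrite !mxE.
have [s' s'E] := lift _ s; have [t' t'E] := lift _ t.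
(* The lifted equation holds up to entries in the kernel of [pr], and these are killed by [eps]. *)
have Es : eps *: (s' *m map_mx phi B) = eps *: (t' *m map_mx phi U).
  have E : map_mx pr (s' *m map_mx phi B - t' *m map_mx phi U) = 0.
    by rewrite map_mxB !map_mxM -!(map_mx_factor _ prP) -s'E -t'E sE subrr.
  apply/eqP; rewrite -subr_eq0 -scalerBr; apply/eqP/rowP => i.
  by rewrite mxE [RHS]mxE; apply: eps0; move/rowP/(_ i): E; rewrite !mxE.
have -> : s = map_mx pr (eps *: s') by rewrite map_mxZ eps1 scale1r.
apply: (row_span_map prP); apply: ex.
exists k, (eps *: t'), U; split=> //.
by rewrite -!scalemxAl.
Qed.

Lemma row_exact_descent (k K : fieldType) (phi : {rmorphism R -> k})
    (psi : {rmorphism R -> K}) (h : {rmorphism k -> K}) :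
    (forall r, h (phi r) = psi r) -> row_exact psi -> row_exact phi.
Proof.
move=> hP ex s sB; apply: (row_span_descent hP); apply: ex.
by rewrite (map_mx_factor _ hP) -map_mxM; apply: row_span_map sB.
Qed.

Section RadRing.
Variable kbar : forall x : spec R, algebraic_closure (residue_field x).
Variable x : spec R.

Definition rad_proj (u : rad_ring kbar) : kbar x := u x.
Lemma rad_proj_zmod : zmod_morphism rad_proj. Proof. by []. Qed.
Lemma rad_proj_monoid : monoid_morphism rad_proj. Proof. by []. Qed.
HB.instance Definition _ :=
  GRing.isZmodMorphism.Build (rad_ring kbar) (kbar x) rad_proj rad_proj_zmod.
HB.instance Definition _ :=
  GRing.isMonoidMorphism.Build (rad_ring kbar) (kbar x) rad_proj rad_proj_monoid.

Lemma rad_proj_surj a : exists u, a = rad_proj u.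
Proof.
(* The family with component [a] at [x], moved along the equality of points, and 0 elsewhere. *)
exists (fun y => if pselect (x = y) is left xy then eq_rect x (fun z => kbar z : Type) a y xy
                 else 0).
rewrite /rad_proj; case: pselect => // xx.
by rewrite (Prop_irrelevance xx erefl).
Qed.

Lemma rad_row_exact : row_exact (to_rad kbar) ->
  row_exact (closure_embed (kbar x) \o @to_residue _ x).
Proof.
(* The idempotent is the indicator function of the point [x]. *)
apply: (@row_exact_factor _ _ _ _ rad_proj (fun y => (`[< y = x >])%:R)) => //.
- exact: rad_proj_surj.
- by rewrite /= /rad_proj asboolT.
move=> u ux; apply: functional_extensionality_dep => y.
change (`[< y = x >]%:R * u y = 0 :> kbar y).
by case: asboolP => [->|_]; rewrite ?mul0r // [u x]ux mulr0.
Qed.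

End RadRing.

(** For the converse of [row_exact_regular], let [x] be the kernel of [k]. Exactness passes to the
    direct factor [kbar x], descends to the residue field at [x], and extends from there to [K]. *)
Lemma row_exact_radE (kbar : forall x : spec R, algebraic_closure (residue_field x)) :
  row_exact (to_rad kbar) <-> row_exact_fields.
Proof.
split=> [ex K k|ex]; last exact/row_exact_regular/rad_ring_regular.
have /row_exact_descent := @rad_row_exact kbar (kernel_prime k) ex.
move=> /(_ _ (@to_residue _ (kernel_prime k)) (closure_embed _) (fun=> erefl)).
apply: (@row_exact_ext _ _ _ _ _ (residue_lift (kernel_primeE k))).
exact: residue_lift_residue.
Qed.

End RowExactness.

(** * Finitely generated subrings *)

Record subring (W : comPzRingType) := Subring {
  sr_pred :> {pred W};
  sr_closed : subring_closed sr_pred }.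

Section SubringType.
Variables (W : comPzRingType) (S : subring W).

Definition sr_mem : {pred W} := fun u => u \in sr_pred S.

HB.instance Definition _ := GRing.isSubringClosed.Build W sr_mem (sr_closed S).

Definition sr_type : Type := {u : W | sr_mem u}.

HB.instance Definition _ := [isSub of sr_type for @sval W sr_mem].
HB.instance Definition _ := [Choice of sr_type by <:].
HB.instance Definition _ :=
  GRing.SubChoice_isSubComPzRing.Build W sr_mem sr_type (sr_closed S).

Definition sr_incl : {rmorphism sr_type -> W} := val.

Lemma sr_incl_inj : injective sr_incl. Proof. exact: val_inj. Qed.
Lemma sr_inclP (x : sr_type) : sr_incl x \in sr_pred S. Proof. exact: (valP x). Qed.
Lemma sr_inclK u : u \in sr_pred S -> exists x, sr_incl x = u.
Proof. by move=> uS; exists (exist _ u uS). Qed.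

Variables (A : comPzRingType) (f : {rmorphism A -> W}).
Hypothesis fS : forall a, f a \in sr_pred S.

Definition corestr : A -> sr_type :=
  fun a => exist _ (f a) (fS a).

Lemma corestrE a : sr_incl (corestr a) = f a.
Proof. by []. Qed.

Lemma corestr_zmod : zmod_morphism corestr.
Proof. by move=> a b; apply: sr_incl_inj; rewrite rmorphB !corestrE rmorphB. Qed.
Lemma corestr_monoid : monoid_morphism corestr.
Proof.
split=> [|a b]; apply: sr_incl_inj; first by rewrite !corestrE !rmorph1.
by rewrite rmorphM !corestrE rmorphM.
Qed.
HB.instance Definition _ :=
  GRing.isZmodMorphism.Build A sr_type corestr corestr_zmod.
HB.instance Definition _ :=
  GRing.isMonoidMorphism.Build A sr_type corestr corestr_monoid.

End SubringType.

Section GeneratedSubring.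
Variables (A W : comPzRingType) (f : {rmorphism A -> W}) (t : seq W).

(** The intersection of all subrings containing the image of [f] and [t]. This has the shape of
    [finite_type], and minimality is immediate. *)
Definition gen_pred : {pred W} := fun u => `[< forall P : {pred W},
  subring_closed P -> (forall a, f a \in P) -> {subset t <= P} -> u \in P >].

Lemma gen_predP : subring_closed gen_pred.
Proof.
split=> [|u v /asboolP gu /asboolP gv|u v /asboolP gu /asboolP gv];
  apply/asboolP => P Pc fP tP; case: (Pc) => P1 PB PM //.
- by apply: PB; [apply: gu | apply: gv].
- by apply: PM; [apply: gu | apply: gv].
Qed.

Definition gen_subring : subring W := Subring gen_predP.
Definition gen_ring : comPzRingType := sr_type gen_subring.
Definition gen_incl : {rmorphism gen_ring -> W} := sr_incl gen_subring.

Lemma gen_base a : f a \in sr_pred gen_subring.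
Proof. by apply/asboolP => P _ fP _. Qed.
Lemma gen_gens : {subset t <= sr_pred gen_subring}.
Proof. by move=> u ut; apply/asboolP => P _ _; apply. Qed.
Lemma gen_min (P : {pred W}) : subring_closed P -> (forall a, f a \in P) ->
  {subset t <= P} -> {subset sr_pred gen_subring <= P}.
Proof. by move=> Pc fP tP u /asboolP; apply. Qed.

Definition gen_str : {rmorphism A -> gen_ring} := corestr gen_base.

Lemma gen_strE a : gen_incl (gen_str a) = f a.
Proof. exact: corestrE. Qed.

Lemma gen_finite_type : finite_type gen_str.
Proof.
exists (pmap (fun u => insub u) t) => P [P1 PB PM] fP tP b.
(* The image of [P] in [W], to which the minimality of the generated subring applies. *)
pose P' : {pred W} := fun u => `[< exists x : gen_ring, gen_incl x = u /\ x \in P >].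
suff /asboolP[x [/sr_incl_inj -> //]] : gen_incl b \in P'.
apply: gen_min (sr_inclP b) => [||u ut].
- split=> [|_ _ /asboolP[x [<- xP]] /asboolP[y [<- yP]]
           |_ _ /asboolP[x [<- xP]] /asboolP[y [<- yP]]]; apply/asboolP.
  + by exists 1; rewrite rmorph1.
  + by exists (x - y); rewrite rmorphB PB.
  + by exists (x * y); rewrite rmorphM PM.
- by move=> a; apply/asboolP; exists (gen_str a); rewrite gen_strE.
apply/asboolP; exists (exist _ u (gen_gens ut)); split=> //.
apply: tP; rewrite mem_pmap; apply/mapP; exists u => //.
case: insubP => [v _ vu|/negP[]]; last exact: gen_gens.
by congr Some; apply: val_inj.
Qed.

(** A prime of [W] over [p] has a trace on the intermediate ring, and this trace also lies over
    [p]. *)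
Lemma gen_surjective : spec_surjective f -> spec_surjective gen_str.
Proof.
move=> fs p; have [q qE] := fs p; exists (spec_pull gen_incl q) => a.
by rewrite spec_pullE gen_strE.
Qed.

End GeneratedSubring.

Lemma gen_mono (A W : comPzRingType) (f : {rmorphism A -> W}) (t t' : seq W) :
  {subset t <= t'} ->
  {subset sr_pred (gen_subring f t) <= sr_pred (gen_subring f t')}.
Proof.
move=> tt'; apply: gen_min; first exact: sr_closed.
  exact: gen_base.
by move=> u /tt'; apply: gen_gens.
Qed.

Lemma subring_closed_preim (A W : comPzRingType) (f : {rmorphism A -> W})
  (P : {pred W}) : subring_closed P -> subring_closed (fun a => f a \in P).
Proof.
move=> [P1 PB PM]; split=> [|u v uP vP|u v uP vP].
- by change (f 1 \in P); rewrite rmorph1.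
- by change (f (u - v) \in P); rewrite rmorphB PB.
- by change (f (u * v) \in P); rewrite rmorphM PM.
Qed.

Lemma finite_type_comp (A B C : comPzRingType) (f : {rmorphism A -> B})
    (g : {rmorphism B -> C}) (h : {rmorphism A -> C}) :
  (forall a, h a = g (f a)) -> finite_type f -> finite_type g -> finite_type h.
Proof.
move=> hP [s sP] [t tP]; exists (map g s ++ t) => P Pc hA stP.
apply: (tP P Pc) => [b|u ut]; last by apply: stP; rewrite mem_cat ut orbT.
apply: (sP (fun b => g b \in P)) => [|a|u us].
- exact: subring_closed_preim.
- by change (g (f a) \in P); rewrite -hP.
- by apply: stP; rewrite mem_cat (map_f g us).
Qed.

Lemma spec_surjective_comp (A B C : comPzRingType) (f : {rmorphism A -> B})
    (g : {rmorphism B -> C}) (h : {rmorphism A -> C}) :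
  (forall a, h a = g (f a)) -> spec_surjective f -> spec_surjective g ->
  spec_surjective h.
Proof.
move=> hP fs gs p; have [q qE] := fs p; have [r rE] := gs q.
by exists r => a; rewrite hP rE qE.
Qed.

(** With the images of generators as [s], this allows the images of several homomorphisms to be
    placed in one finitely generated subring of [W]. *)
Lemma finite_type_image (A B W : comPzRingType) (f : {rmorphism A -> B})
    (h : {rmorphism A -> W}) (g : {rmorphism B -> W}) : finite_type f ->
  (forall a, g (f a) = h a) ->
  exists s : seq W, forall S : subring W, (forall a, h a \in sr_pred S) ->
    {subset s <= sr_pred S} -> forall b, g b \in sr_pred S.
Proof.
move=> [s sP] gf; exists (map g s) => S hS sS b.
apply: (sP (fun b => g b \in sr_pred S)) => [|a|u us].
- exact/subring_closed_preim/sr_closed.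
- by change (g (f a) \in sr_pred S); rewrite gf.
- exact: sS (map_f g us).
Qed.

Lemma sr_lift_row (W : comPzRingType) (S : subring W) n (t : 'rV[W]_n) :
  (forall i, t 0 i \in sr_pred S) -> exists t', t = map_mx (sr_incl S) t'.
Proof.
move=> tS; have [t' t'E] := choice (fun i => sr_inclK (tS i)).
by exists (\row_i t' i); apply/rowP => i; rewrite !mxE t'E.
Qed.

Lemma map_mx_inj_fun (A B : comPzRingType) (g : A -> B) m n :
  injective g -> injective (@map_mx A B g m n).
Proof.
by move=> gi U V /matrixP UV; apply/matrixP => i j; have := UV i j; rewrite !mxE => /gi.
Qed.

(* A span relation over W only involves finitely many coefficients. *)
Lemma row_span_coeffs (R W : comPzRingType) (psi : {rmorphism R -> W}) n
    (P : 'rV[R]_n -> Prop) (s : 'rV[W]_n) : row_span P psi s ->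
  exists c : seq W, forall (S : subring W) (phi : {rmorphism R -> sr_type S}) s',
    (forall r, sr_incl S (phi r) = psi r) -> {subset c <= sr_pred S} ->
    s = map_mx (sr_incl S) s' -> row_span P phi s'.
Proof.
move=> [k [t [U [PU sE]]]]; exists [seq t 0 i | i <- enum 'I_k].
move=> S phi s' phiE cS s'E.
have [i|t' t'E] := @sr_lift_row _ S _ t; first by apply/cS/map_f; rewrite mem_enum.
exists k, t', U; split=> //.
apply: (map_mx_inj_fun (@sr_incl_inj _ S)).
by rewrite -s'E sE t'E map_mxM -(map_mx_factor _ phiE).
Qed.

(** * The conditions (i), (ii) and (iv) *)

Section Radical.
Variables (R S : comPzRingType) (phi : {rmorphism R -> S}).
Variables (N M : lmodType R) (alpha : {linear N -> M}).
Variables (m : nat) (e : 'I_m -> M).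
Hypothesis eG : generating e.

Let E (i : 'I_m) : base_change phi M := pure phi (e i) 1.

Lemma bc_comb_lincomb s : bc_comb e phi s = lincomb E s.
Proof. by apply: eq_bigr => i _; rewrite scale_pure mulr1. Qed.

Lemma base_change_generating : generating E.
Proof.
by move=> x; have [s ->] := bc_comb_surj eG x; exists s; rewrite bc_comb_lincomb.
Qed.

(** In terms of the generators [E], the image submodule consists of the combinations whose row over
    [S] lies in the span of [image_row e alpha]. Extending to [K] is then a base change in two
    steps, handled by [row_span_trans]. *)
Lemma in_radical_rows s :
  in_radical (image_of (bc_map phi alpha)) (bc_comb e phi s) <->
  forall (K : fieldType) (k : {rmorphism S -> K}),
    row_span (image_row e alpha) (k \o phi) (map_mx k s).
Proof.
have imE r : image_row E (sub_incl (image_of (bc_map phi alpha))) r <->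
    row_span (image_row e alpha) phi r.
  split=> [[[x xP] xE]|/(bc_comb_imageP _ eG)[y yE]].
    have /asboolP[y yx] := xP; by apply/bc_comb_imageP => //; exists y; rewrite yx bc_comb_lincomb -xE.
  have xP : sub_mem (image_of (bc_map phi alpha)) (bc_map phi alpha y).
    by apply/asboolP; exists y.
  by exists (exist (fun x => is_true (sub_mem (image_of (bc_map phi alpha)) x)) _ xP); rewrite -bc_comb_lincomb -yE.
have radE (K : fieldType) (k : {rmorphism S -> K}) :
    pure k (bc_comb e phi s) 1 = bc_comb E k (map_mx k s).
  by rewrite -[map_mx k s]scale1r bc_comb_map bc_comb_lincomb.
split=> rad K k.
  apply/row_span_trans/(row_span_iff _ _ imE)/(bc_comb_imageP _ base_change_generating).
  by have [z zE] := rad K k; exists z; rewrite -radE.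
rewrite radE; apply/(bc_comb_imageP _ base_change_generating)/(row_span_iff _ _ imE).
exact/row_span_trans.
Qed.

End Radical.

Section Site.
Variables (R : comPzRingType) (c : algebra_class).

Lemma finite_type_in_class (A : comPzRingType) (f : {rmorphism R -> A}) :
  finite_type f -> in_class c f.
Proof. by case: c. Qed.

Lemma in_class_comp (A : obj R c) (D : comPzRingType) (g : {rmorphism A -> D}) :
  finite_type g -> in_class c (g \o obj_str A).
Proof.
have := obj_class A; case: c A g => //= A g Aft gft.
exact: finite_type_comp Aft gft.
Qed.

Definition ext_obj (A : obj R c) (D : comPzRingType) (g : {rmorphism A -> D})
  (gft : finite_type g) : obj R c := Obj (in_class_comp gft).

Definition ext_hom (A : obj R c) (D : comPzRingType) (g : {rmorphism A -> D})
  (gft : finite_type g) : hom A (ext_obj gft) := @Hom _ _ A (ext_obj gft) g (fun=> erefl).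

Lemma covering_comp (A B C : obj R c) (g : hom B C) (f : hom A B) :
  covering f -> covering g -> covering (hom_comp g f).
Proof.
move=> [fft fs] [gft gs]; split.
  exact: finite_type_comp fft gft.
exact: spec_surjective_comp fs gs.
Qed.

Lemma mod_res_comb (M : lmodType R) m (e : 'I_m -> M) (A B : obj R c) (g : hom A B) s :
  psh_res (mod_presheaf c M) g (bc_comb e (obj_str A) s) =
  bc_comb e (obj_str B) (map_mx g s).
Proof.
rewrite raddf_sum; apply: eq_bigr => i _ /=.
by rewrite bc_res_pure mxE.
Qed.

Section Solvability.
Variables (m : nat) (P : 'rV[R]_m -> Prop).

Definition locally_spanned (A : obj R c) (s : 'rV[A]_m) : Prop :=
  exists (D : obj R c) (u : hom A D),
    covering u /\ row_span P (obj_str D) (map_mx u s).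

Definition pointwise_spanned (A : comPzRingType) (phi : R -> A) (s : 'rV[A]_m) : Prop :=
  forall (K : fieldType) (k : {rmorphism A -> K}), row_span P (k \o phi) (map_mx k s).

(* For the converse direction, the coefficients of a solution in the product
   of all residue fields generate a covering. *)
Lemma locally_spannedE (A : obj R c) (s : 'rV[A]_m) :
  locally_spanned s <-> pointwise_spanned (obj_str A) s.
Proof.
split=> [[D [u [[_ us] Ps]]] K k|Ps].
  exact: (row_span_surjective us (hom_str u) Ps).
pose W := residue_prod A; pose psi : {rmorphism A -> W} := @to_prod A.
have : row_span P (psi \o obj_str A) (map_mx psi s).
  apply: regular_row_span => [|p]; first exact: field_prod_regular.
  have := Ps _ (@to_residue _ p \o psi).
  by rewrite (@map_mx_factor _ _ _ psi (@to_residue _ p \o psi) (@to_residue _ p)).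
case/row_span_coeffs => t tP; have gft := gen_finite_type psi t.
exists (ext_obj gft), (ext_hom gft); split.
  split=> //=; exact/gen_surjective/to_prod_surjective.
by apply: (tP (gen_subring psi t)) => [r||]; [exact: gen_strE|exact: gen_gens|
  exact: map_mx_factor].
Qed.

End Solvability.
End Site.

(** * Exactness of the complex of sheaves *)

Section Sections.
Variables (R : comPzRingType) (c : algebra_class).

Lemma hom_comp_idr (A B : obj R c) (g : hom A B) : hom_comp g (hom_id A) = g.
Proof. exact: hom_ext. Qed.
Lemma hom_comp_idl (A B : obj R c) (g : hom A B) : hom_comp (hom_id B) g = g.
Proof. exact: hom_ext. Qed.

Variables (N M L : lmodType R) (alpha : {linear N -> M}) (beta : {linear M -> L}).
Variables (m l : nat) (e : 'I_m -> M) (f : 'I_l -> L) (B : 'M[R]_(m, l)).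
Hypotheses (eG : generating e) (fG : generating f).
Hypothesis BE : forall i, beta (e i) = lincomb f (row i B).
Hypothesis alpha_beta : forall n, beta (alpha n) = 0.

Notation PM := (image_row e alpha).
Notation PL := (relation_row f).

Lemma bc_map_comb_eq0 (S : comPzRingType) (phi : {rmorphism R -> S}) s :
  bc_map phi beta (bc_comb e phi s) = 0 <-> row_span PL phi (s *m map_mx phi B).
Proof. by rewrite (bc_map_comb BE); apply: bc_comb_eq0. Qed.

Lemma unit_push_eq0 (A : obj R c) (x : mod_presheaf c M A) :
  bc_map (obj_str A) beta x = 0 ->
  sec_eq (sec_push (mod_morphism c beta) (sheafify_unit x)) (sheafify_unit 0).
Proof.
move=> x0; exists A, (hom_id A), (hom_id A), (hom_id A).
split; rewrite ?hom_comp_idr //; first exact: hom_id_covering.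
by congr (psh_res _ _ _).
Qed.

(** After refining its covering, a section killed by [beta] is represented by an element of the
    tensor product that is itself killed by [beta]. *)
Lemma push_eq0_cover (A : obj R c) (s : sheaf_section (mod_presheaf c M) A) :
    sec_eq (sec_push (mod_morphism c beta) s) (sheafify_unit 0) ->
  exists (D : obj R c) (u : hom A D) (a : hom (sec_cover s) D),
    [/\ covering u, hom_comp a (sec_map s) = u &
      bc_map (obj_str D) beta (psh_res (mod_presheaf c M) a (sec_val s)) = 0].
Proof.
move=> [D [u [a [b [uc au _ ab]]]]]; exists D, u, a; split=> //.
  by rewrite au hom_comp_idr.
transitivity (psh_res (mod_presheaf c L) a (mod_morphism c beta _ (sec_val s))).
  by rewrite -psh_natural.
by rewrite ab raddf0.
Qed.

Lemma image_locally_spanned (A D : obj R c) (u : hom A D) (s : 'rV[A]_m)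
    (y : mod_presheaf c N D) : covering u ->
    psh_res (mod_presheaf c M) u (bc_comb e (obj_str A) s) =
      mod_morphism c alpha D y ->
  locally_spanned PM s.
Proof.
move=> uc E; exists D, u; split=> //.
by apply: (bc_comb_row_span eG (y := y)); rewrite -mod_res_comb.
Qed.

Lemma sheaf_exact_locally (A : obj R c) (s : 'rV[A]_m) :
    sheaf_exact (mod_morphism c alpha) (mod_morphism c beta) ->
  row_span PL (obj_str A) (s *m map_mx (obj_str A) B) -> locally_spanned PM s.
Proof.
move=> ex /bc_map_comb_eq0/unit_push_eq0/ex[D [u [uc [t [C [v [a [b]]]]]]]].
rewrite hom_comp_idr => -[vc au _ ab].
apply: (@image_locally_spanned A C a s (psh_res (mod_presheaf c N) b (sec_val t))).
  by rewrite au; apply: covering_comp.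
by rewrite [RHS]psh_natural -ab.
Qed.

Lemma sections_exact_locally (A : obj R c) (s : 'rV[A]_m) :
    sections_exact (mod_morphism c alpha) (mod_morphism c beta) A ->
  row_span PL (obj_str A) (s *m map_mx (obj_str A) B) -> locally_spanned PM s.
Proof.
move=> ex /bc_map_comb_eq0/unit_push_eq0/ex[t [C [v [a [b]]]]].
rewrite !hom_comp_idr => -[vc _ bv ab].
apply: (@image_locally_spanned A C b s (psh_res (mod_presheaf c N) a (sec_val t))).
  by rewrite bv.
by rewrite [RHS]psh_natural -[LHS]ab.
Qed.

Lemma row_exact_fields_locally (A : obj R c) (s : 'rV[A]_m) :
    row_exact_fields alpha e f B ->
  row_span PL (obj_str A) (s *m map_mx (obj_str A) B) -> locally_spanned PM s.
Proof.
move=> ex sB; apply/locally_spannedE => K k; apply: ex.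
rewrite (@map_mx_factor _ _ _ (obj_str A) (k \o obj_str A) k) // -map_mxM.
exact: row_span_map sB.
Qed.

(** A representative killed by [beta] is a row satisfying the linear system, so exactness over
    fields makes it locally a combination of image rows. The resulting preimage is a section given
    on the identity covering. *)
Lemma fields_sheaf_exact : row_exact_fields alpha e f B ->
  sheaf_exact (mod_morphism c alpha) (mod_morphism c beta).
Proof.
move=> ex A s /push_eq0_cover[D [u [a [uc au]]]].
have [r rE] := bc_comb_surj eG (psh_res (mod_presheaf c M) a (sec_val s)).
rewrite rE => /bc_map_comb_eq0/(row_exact_fields_locally ex)[C [v [vc]]].
move=> /row_span_bc_comb[y yE].
exists C, (hom_comp v u); split; first exact: covering_comp.
exists (sheafify_unit (y : mod_presheaf c N C)), C, (hom_id C), (hom_comp v a), (hom_id C).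
split=> //; first exact: hom_id_covering.
- by rewrite hom_comp_idl -au; apply: hom_ext.
- exact: hom_comp_idl.
- rewrite psh_res_comp rE mod_res_comb psh_res_id; exact/esym.
Qed.

(* Exactness over K only involves the subring of K generated by finitely many
   coefficients. *)
Lemma finite_type_row_exact_fields :
    (forall (A : obj R c) (s : 'rV[A]_m), finite_type (obj_str A) ->
       row_span PL (obj_str A) (s *m map_mx (obj_str A) B) ->
       pointwise_spanned PM (obj_str A) s) ->
  row_exact_fields alpha e f B.
Proof.
move=> H K k s /row_span_coeffs[t tP].
pose w := [seq s 0 i | i <- enum 'I_m] ++ t.
have gft := gen_finite_type k w.
have [i|s' sE] := @sr_lift_row _ (gen_subring k w) _ s.
  by apply: gen_gens; rewrite mem_cat map_f // mem_enum.
pose A : obj R c := Obj (finite_type_in_class c gft).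
have /(H A s' gft)/(_ K (gen_incl k w)) : row_span PL (gen_str k w) (s' *m map_mx (gen_str k w) B).
  apply: (tP (gen_subring k w)) => [r|u ut|]; first exact: gen_strE.
    by apply: gen_gens; rewrite mem_cat ut orbT.
  by rewrite map_mxM -sE -(@map_mx_factor _ _ _ _ k) // => r; apply: gen_strE.
rewrite -sE; case=> [j [x [U [PU E]]]]; exists j, x, U; split=> //.
Qed.

Lemma radical_row_exact_fields :
    (forall (A : obj R c) (x : base_change (obj_str A) M),
       bc_map (obj_str A) beta x = 0 ->
       in_radical (image_of (bc_map (obj_str A) alpha)) x) ->
  row_exact_fields alpha e f B.
Proof.
move=> H; apply: finite_type_row_exact_fields => A s _.
by move=> /bc_map_comb_eq0/H/in_radical_rows-/(_ eG).
Qed.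

Lemma sheaf_exact_radical : sheaf_exact (mod_morphism c alpha) (mod_morphism c beta) ->
  forall (A : obj R c) (x : base_change (obj_str A) M),
    bc_map (obj_str A) beta x = 0 ->
    in_radical (image_of (bc_map (obj_str A) alpha)) x.
Proof.
move=> ex A x; have [s ->] := bc_comb_surj eG x.
move=> /bc_map_comb_eq0/(sheaf_exact_locally ex)/locally_spannedE Ps.
exact/in_radical_rows.
Qed.

Lemma sections_exact_row_exact_fields :
    (forall A : obj R c, finite_type (obj_str A) ->
       sections_exact (mod_morphism c alpha) (mod_morphism c beta) A) ->
  row_exact_fields alpha e f B.
Proof.
move=> H; apply: finite_type_row_exact_fields => A s Aft.
by move=> /(sections_exact_locally (H A Aft))/locally_spannedE.
Qed.

Lemma push_push_eq0 (A : obj R c) (s : sheaf_section (mod_presheaf c M) A)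
    (t : sheaf_section (mod_presheaf c N) A) :
  sec_eq (sec_push (mod_morphism c alpha) t) s ->
  sec_eq (sec_push (mod_morphism c beta) s) (sheafify_unit 0).
Proof.
move=> [D [u [a [b [uc au bu ab]]]]]; exists D, u, b, u; split=> //.
- by rewrite bu hom_comp_idr.
- by rewrite hom_comp_idr.
rewrite raddf0 -[LHS]psh_natural -ab -[X in mod_morphism _ _ _ X]psh_natural.
exact: bc_map_comp0.
Qed.

End Sections.

(** * Tensor products of fields *)

Section AlgebraModule.
Variables (R A : comPzRingType) (phi : {rmorphism R -> A}).

(** A copy of [A] whose type remembers [phi], so that the module structure through [phi] can be
    inferred. *)
Definition alg_mod of {rmorphism R -> A} : Type := A.
Notation V := (alg_mod phi).

HB.instance Definition _ := GRing.ComPzRing.on V.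

Definition am_scale (r : R) (a : V) : V := phi r * a.

Lemma am_scaleA r s a : am_scale r (am_scale s a) = am_scale (r * s) a.
Proof. by rewrite /am_scale rmorphM mulrA. Qed.
Lemma am_scale1 : left_id 1 am_scale.
Proof. by move=> a; rewrite /am_scale rmorph1 mul1r. Qed.
Lemma am_scaleDr : right_distributive am_scale +%R.
Proof. by move=> r a b; rewrite /am_scale mulrDr. Qed.
Lemma am_scaleDl a : {morph am_scale^~ a : r s / r + s}.
Proof. by move=> r s; rewrite /am_scale rmorphD mulrDl. Qed.

HB.instance Definition _ := GRing.Zmodule_isLmodule.Build R V
  am_scaleA am_scale1 am_scaleDr am_scaleDl.

Lemma alg_scaleE r (a : V) : r *: a = phi r * a.
Proof. by []. Qed.

Lemma alg_scaleAl r (a b : V) : (r *: a) * b = r *: (a * b).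
Proof. by rewrite !alg_scaleE mulrA. Qed.

Definition am_mul (a : V) : V -> V := fun x => a * x.

Lemma am_mul_zmod a : zmod_morphism (am_mul a).
Proof. by move=> x y; rewrite /am_mul mulrBr. Qed.
Lemma am_mul_scalable a : scalable (am_mul a).
Proof. by move=> r x; rewrite /am_mul !alg_scaleE mulrCA. Qed.

HB.instance Definition _ a :=
  GRing.isZmodMorphism.Build V V (am_mul a) (am_mul_zmod a).
HB.instance Definition _ a :=
  GRing.isScalable.Build R V V *:%R (am_mul a) (am_mul_scalable a).

End AlgebraModule.

Section TensorRing.
Variables (R A B : comPzRingType).
Variables (phi : {rmorphism R -> A}) (psi : {rmorphism R -> B}).

Notation V := (alg_mod phi).

Definition tensor_ring : Type := base_change psi V.
Notation T := tensor_ring.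
HB.instance Definition _ := GRing.Lmodule.on T.

Notation pt a b := (pure psi (a : V) b : T).

(** Multiplication of [y] by the pure tensor of [a] and [b]. It is balanced in [a] and [b], and thus
    extends to the product of the ring. *)
Definition tr_act (y : T) (a : V) (b : B) : T := b *: bc_map psi (am_mul a) y.

Lemma tr_act_pure a b a' b' : tr_act (pt a' b') a b = pt (a * a') (b * b').
Proof. by rewrite /tr_act bc_map_pure scale_pure. Qed.

Lemma tr_act0 a b : tr_act 0 a b = 0.
Proof. by rewrite /tr_act raddf0 scaler0. Qed.
Lemma tr_actD y z a b : tr_act (y + z) a b = tr_act y a b + tr_act z a b.
Proof. by rewrite /tr_act raddfD scalerDr. Qed.

Lemma tr_act_balanced y : balanced psi (tr_act y).
Proof.
split; elim/base_change_ind: y => [|m s y IH] *; rewrite ?tr_act0 ?addr0 //.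
- by rewrite !tr_actD IH !tr_act_pure mulrDl pureDl addrACA.
- by rewrite !tr_actD IH !tr_act_pure mulrDl pureDr addrACA.
- by rewrite !tr_actD IH !tr_act_pure alg_scaleAl pureZl mulrA.
Qed.

Definition tr_mul (x y : T) : T := tensor_value (tr_act y) x.
Definition tr_one : T := pt 1 1.

Lemma tr_mul_pure a b y : tr_mul (pt a b) y = tr_act y a b.
Proof. exact: tensor_value_pure (tr_act_balanced y). Qed.
Lemma tr_mul0 y : tr_mul 0 y = 0.
Proof. exact: (tensor_value0 (tr_act_balanced y)). Qed.
Lemma tr_mulDl : left_distributive tr_mul +%R.
Proof. by move=> x z y; exact: (tensor_valueD (tr_act_balanced y)). Qed.
Lemma tr_mulr0 x : tr_mul x 0 = 0.
Proof.
elim/base_change_ind: x => [|a b x IH]; first exact: tr_mul0.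
by rewrite tr_mulDl IH tr_mul_pure tr_act0 addr0.
Qed.
Lemma tr_mulDr : right_distributive tr_mul +%R.
Proof.
move=> x y z; elim/base_change_ind: x => [|a b x IH]; first by rewrite !tr_mul0 addr0.
by rewrite !tr_mulDl IH !tr_mul_pure tr_actD addrACA.
Qed.
Lemma tr_mulC : commutative tr_mul.
Proof.
move=> x y; elim/base_change_ind: x => [|a b x IH]; first by rewrite tr_mul0 tr_mulr0.
rewrite tr_mulDl tr_mulDr IH; congr (_ + _).
elim/base_change_ind: y {IH} => [|a' b' y IH]; first by rewrite tr_mul0 tr_mulr0.
by rewrite tr_mulDl tr_mulDr IH !tr_mul_pure !tr_act_pure mulrC [b * _]mulrC.
Qed.
Lemma tr_mulA : associative tr_mul.
Proof.
move=> x y z; elim/base_change_ind: x => [|a b x IHx]; first by rewrite !tr_mul0.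
rewrite !tr_mulDl IHx; congr (_ + _).
elim/base_change_ind: y {IHx} => [|a' b' y IH].
  by rewrite tr_mul0 !tr_mulr0 tr_mul0.
rewrite tr_mulDl !tr_mulDr tr_mulDl IH; congr (_ + _).
elim/base_change_ind: z {IH} => [|a'' b'' z IH]; first by rewrite !tr_mulr0.
by rewrite !tr_mulDr IH !(tr_mul_pure, tr_act_pure) !mulrA.
Qed.
Lemma tr_mul1 : left_id tr_one tr_mul.
Proof.
move=> x; elim/base_change_ind: x => [|a b x IH]; first exact: tr_mulr0.
by rewrite tr_mulDr IH tr_mul_pure tr_act_pure !mul1r.
Qed.

HB.instance Definition _ := GRing.Zmodule_isComPzRing.Build T
  tr_mulA tr_mulC tr_mul1 tr_mulDl.

Lemma tr_mulE a b a' b' : pt a b * pt a' b' = pt (a * a') (b * b').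
Proof. by rewrite -tr_act_pure -tr_mul_pure. Qed.

Definition tensor_inl (a : A) : T := pt a 1.
Definition tensor_inr (b : B) : T := pt 1 b.

Lemma tensor_inl_zmod : zmod_morphism tensor_inl.
Proof.
move=> a a'; apply: (addIr (tensor_inl a')).
by rewrite subrK /tensor_inl -pureDl subrK.
Qed.
Lemma tensor_inl_monoid : monoid_morphism tensor_inl.
Proof. by split=> // a a'; rewrite /tensor_inl tr_mulE mul1r. Qed.
Lemma tensor_inr_zmod : zmod_morphism tensor_inr.
Proof. by move=> b b'; rewrite /tensor_inr pureDr pureNr. Qed.
Lemma tensor_inr_monoid : monoid_morphism tensor_inr.
Proof. by split=> // b b'; rewrite /tensor_inr tr_mulE mul1r. Qed.

HB.instance Definition _ := GRing.isZmodMorphism.Build A T tensor_inl tensor_inl_zmod.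
HB.instance Definition _ :=
  GRing.isMonoidMorphism.Build A T tensor_inl tensor_inl_monoid.
HB.instance Definition _ := GRing.isZmodMorphism.Build B T tensor_inr tensor_inr_zmod.
HB.instance Definition _ :=
  GRing.isMonoidMorphism.Build B T tensor_inr tensor_inr_monoid.

Lemma tensor_in_base r : tensor_inl (phi r) = tensor_inr (psi r).
Proof.
by rewrite /tensor_inl /tensor_inr -[phi r]mulr1 -alg_scaleE pureZl mulr1.
Qed.

End TensorRing.

(** A submodule [N] containing [N0] and maximal among those missing [v] is a complement of the line
    through [v]; [lam] is the coordinate along [v]. *)
Lemma linear_functional (k : fieldType) (V : lmodType k) (N0 : V -> Prop) (v : V) :
    is_submodule N0 -> ~ N0 v ->
  exists lam : V -> k, [/\ forall a u w, lam (a *: u + w) = a * lam u + lam w,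
    forall u, N0 u -> lam u = 0 & lam v = 1].
Proof.
move=> N0s N0v; have [u N0u uv|N [[N_0 ND] N0N NZ Nmax]] :=
  @maximal_submodule k V N0 (fun u => u = v) N0s; first by rewrite uv in N0u.
have Nv : ~ N v by move=> /NZ.
have NZl a u : N u -> N (a *: u) by move=> Nu; rewrite -[_ *: _]addr0; apply: ND.
have ex w : exists a, N (w - a *: v).
  have [Nw|/Nmax[a [u [Nu E]]]] := EM (N w); first by exists 0; rewrite scale0r subr0.
  have a0 : a != 0 by apply/eqP => a0; apply: Nv; rewrite -E a0 scale0r add0r.
  exists a^-1; rewrite -E scalerDr scalerA mulVf // scale1r opprD addNKr -scaleNr.
  exact: NZl.
have [lam lamP] := choice ex.
have uniq a w : N (w - a *: v) -> lam w = a.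
  move=> Na; apply/eqP; rewrite -subr_eq0; apply/negPn/negP => d0; apply: Nv.
  have -> : v = (lam w - a)^-1 *: ((-1) *: (w - lam w *: v) + (w - a *: v)).
    by rewrite scaleN1r opprB addrA subrK -scalerBl scalerA mulVf // scale1r.
  exact/NZl/ND.
exists lam; split=> [a u w|u N0u|].
- apply: uniq; rewrite scalerDl opprD addrACA -scalerA -scalerBr.
  exact: ND.
- by apply: uniq; rewrite scale0r subr0; apply: N0N.
- by apply: uniq; rewrite scale1r subrr.
Qed.

Section TensorFields.
Variables (k k1 k2 : fieldType) (i1 : {rmorphism k -> k1}) (i2 : {rmorphism k -> k2}).

Notation T := (tensor_ring i1 i2).
Notation inl := (tensor_inl i1 i2).
Notation inr := (tensor_inr i1 i2).

(** A functional that is 1 on [u i] and 0 on the other [u j] induces a map from the tensor product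
    to [k2]. Applied to the relation, it leaves [b i]. *)
Lemma tensor_free d (u : 'I_d -> k1) (b : 'I_d -> k2) :
    (forall c : 'I_d -> k, \sum_i i1 (c i) * u i = 0 -> forall i, c i = 0) ->
  \sum_i inl (u i) * inr (b i) = 0 :> T -> forall i, b i = 0.
Proof.
move=> free E i; pose V := alg_mod i1.
(* The span over [k] of the [u j] with [j] different from [i]. *)
pose N0 (w : V) := exists c : 'I_d -> k, c i = 0 /\ w = \sum_j i1 (c j) * u j.
have N0s : is_submodule N0.
  split; first by exists (fun=> 0); split=> //; rewrite big1 // => j _; rewrite rmorph0 mul0r.
  move=> a _ _ [c [ci ->]] [c' [c'i ->]]; exists (fun j => a * c j + c' j).
  split; first by rewrite ci c'i mulr0 addr0.
  rewrite alg_scaleE mulr_sumr -big_split; apply: eq_bigr => j _ /=.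
  by rewrite rmorphD rmorphM mulrDl mulrA.
have N0u : ~ N0 (u i).
  move=> [c [ci E']]; suff : c i - (i == i)%:R = 0.
    by rewrite ci eqxx sub0r => /eqP; rewrite oppr_eq0 oner_eq0.
  apply: (free (fun j => c j - (j == i)%:R)).
  under eq_bigr do rewrite rmorphB mulrBl.
  rewrite sumrB -E' (bigD1 i) //= eqxx rmorph1 mul1r big1 ?addr0 ?subrr // => j /negPf->.
  by rewrite rmorph0 mul0r.
have [lam [lamL lam0 lam1]] := linear_functional N0s N0u.
have lamD u' w : lam (u' + w) = lam u' + lam w.
  by have := lamL 1 u' w; rewrite scale1r mul1r.
have lam00 : lam 0 = 0 by apply: (addrI (lam 0)); rewrite -lamD !addr0.
have bal : balanced i2 (fun (a : V) (s : k2) => i2 (lam a) * s).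
  split=> [a a' s|a s s'|r a s]; first by rewrite lamD rmorphD mulrDl.
    by rewrite mulrDr.
  by have := lamL r a 0; rewrite !addr0 lam00 addr0 => ->; rewrite rmorphM; ring.
pose val : T -> k2 := tensor_value (fun (a : V) (s : k2) => i2 (lam a) * s).
have valD : {morph val : x y / x + y} by exact: (tensor_valueD bal).
have val0 : val 0 = 0 by exact: (tensor_value0 bal).
have valE j : val (inl (u j) * inr (b j)) = i2 (lam (u j)) * b j.
  rewrite /tensor_inl /tensor_inr tr_mulE mulr1 mul1r.
  exact: (tensor_value_pure _ _ bal).
have := congr1 val E; rewrite (big_morph _ valD val0) val0.
rewrite (bigD1 i) //= valE lam1 rmorph1 mul1r big1 ?addr0 // => j ji.
rewrite valE (_ : lam (u j) = 0) ?rmorph0 ?mul0r //; apply: lam0.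
exists (fun j' => (j' == j)%:R); rewrite eq_sym (negPf ji); split=> //.
rewrite (bigD1 j) //= eqxx rmorph1 mul1r big1 ?addr0 // => j' /negPf->.
by rewrite rmorph0 mul0r.
Qed.

Lemma tensor_fields_neq0 : (1 : T) <> 0.
Proof.
move=> E; suff /eqP : (1 : k2) = 0 by rewrite oner_eq0.
apply: (@tensor_free 1 (fun=> 1) (fun=> 1) _ _ ord0).
  move=> c; rewrite big_ord1 mulr1 => /eqP; rewrite fmorph_eq0 => /eqP c0 i.
  by rewrite [i]ord1.
by rewrite big_ord1 !rmorph1 mulr1.
Qed.

(** The tensor product of two field extensions is nonzero, so it has a prime, and the residue field
    there receives both. *)
Lemma compositum : exists (K : fieldType) (a : {rmorphism k1 -> K})
  (b : {rmorphism k2 -> K}), forall r, a (i1 r) = b (i2 r).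
Proof.
have [||p _] := @prime_containing T (fun x => x = 0).
- by split=> // a u v -> ->; rewrite mulr0 addr0.
- exact: tensor_fields_neq0.
exists (residue_field p), (@to_residue _ p \o inl), (@to_residue _ p \o inr).
by move=> r /=; rewrite tensor_in_base.
Qed.

End TensorFields.

Section SelfTensor.
Variables (k K : fieldType) (i : {rmorphism k -> K}) (x : K).

Notation T := (tensor_ring i i).
Notation inl := (tensor_inl i i).
Notation inr := (tensor_inr i i).

(* The value at 'X = inl x of a polynomial with coefficients in the right factor. *)
Definition tensor_eval (g : {poly K}) : T :=
  \sum_(j < size g) inl (x ^+ j) * inr g`_j.

Lemma tensor_evalE n (g : {poly K}) : (size g <= n)%N ->
  tensor_eval g = \sum_(j < n) inl (x ^+ j) * inr g`_j.
Proof.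
move=> gn; rewrite /tensor_eval (big_ord_widen n (fun j => inl (x ^+ j) * inr g`_j) gn).
rewrite big_mkcond; apply: eq_bigr => j _; case: ltnP => // gj.
by rewrite nth_default // rmorph0 mulr0.
Qed.

Lemma tensor_evalD g h : tensor_eval (g + h) = tensor_eval g + tensor_eval h.
Proof.
pose n := maxn (size g) (size h).
rewrite !(@tensor_evalE n) ?leq_maxl ?leq_maxr ?size_polyD //.
by rewrite -big_split; apply: eq_bigr => j _; rewrite coefD rmorphD mulrDr.
Qed.

Lemma tensor_evalC c : tensor_eval c%:P = inr c.
Proof.
by rewrite (@tensor_evalE 1) ?size_polyC_leq1 // big_ord1 coefC rmorph1 mul1r.
Qed.

Lemma tensor_evalCM c g : tensor_eval (c%:P * g) = inr c * tensor_eval g.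
Proof.
rewrite !(@tensor_evalE (size g)) //; last by rewrite mul_polyC size_scale_leq.
by rewrite mulr_sumr; apply: eq_bigr => j _; rewrite coefCM rmorphM mulrCA.
Qed.

Lemma tensor_evalMX g : tensor_eval (g * 'X) = tensor_eval g * inl x.
Proof.
rewrite (@tensor_evalE (size g).+1); last by rewrite (leq_trans (size_polyMleq _ _)) ?size_polyX ?addn2.
rewrite big_ord_recl coefMX eqxx rmorph0 mulr0 add0r mulr_suml.
by apply: eq_bigr => j _; rewrite coefMX /= exprSr rmorphM mulrAC.
Qed.

Lemma tensor_evalM g h : tensor_eval (g * h) = tensor_eval g * tensor_eval h.
Proof.
elim/poly_ind: g => [|g c IH].
  by rewrite mul0r -[0]polyC0 tensor_evalC rmorph0 mul0r.
rewrite mulrDl !tensor_evalD tensor_evalCM tensor_evalC mulrDl; congr (_ + _).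
by rewrite -mulrA ['X * h]mulrC mulrA !tensor_evalMX IH mulrAC.
Qed.

Lemma tensor_evalX n g : tensor_eval (g ^+ n) = tensor_eval g ^+ n.
Proof.
elim: n => [|n IH]; first by rewrite !expr0 -[1]polyC1 tensor_evalC rmorph1.
by rewrite !exprS tensor_evalM IH.
Qed.

Lemma tensor_eval_root (f : {poly k}) :
  root (map_poly i f) x -> tensor_eval (map_poly i f) = 0.
Proof.
move=> /eqP; rewrite horner_coef => fx.
rewrite -(rmorph0 inl) -fx rmorph_sum; apply: eq_bigr => j _.
by rewrite coef_map mulrC rmorphM -tensor_in_base mulrC.
Qed.

Hypothesis char0 : forall n, n.+1%:R != 0 :> k.

(* If f is the minimal polynomial of x over k, then f divides ('X - x) ^+ n over K,
   so f = ('X - x) ^+ d, which is separable only if d = 1. *)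
Lemma nilpotent_difference_base n : (inl x - inr x) ^+ n = 0 -> exists y, x = i y.
Proof.
move=> zn.
have evn : tensor_eval (('X - x%:P) ^+ n) = 0.
  rewrite tensor_evalX tensor_evalD -polyCN tensor_evalC rmorphN.
  by rewrite -['X]mul1r tensor_evalMX -[1]polyC1 tensor_evalC rmorph1 mul1r.
pose ann (d : nat) := `[< exists f : {poly k},
  [/\ f != 0, root (map_poly i f) x & size f = d] >].
(* If no nonzero polynomial over [k] of size at most [d] vanishes at [x], the powers of [x] with
   exponent less than [d] are independent over [k], and [tensor_free] applies to them. *)
have size0 (g : {poly K}) d : (size g <= d)%N -> tensor_eval g = 0 ->
    (forall f : {poly k}, (size f <= d)%N -> root (map_poly i f) x -> f = 0) -> g = 0.
  move=> gd g0 dmin; apply/polyP => j; rewrite coef0.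
  have [dj|jd] := leqP d j; first by rewrite nth_default // (leq_trans gd).
  move: g0; rewrite (@tensor_evalE d) // => g0.
  apply: (@tensor_free _ _ _ i i d (fun j => x ^+ j) (fun j => g`_j) _ g0 (Ordinal jd)).
  move=> c cx j'; pose E (j : nat) : k := if insub j is Some j1 then c j1 else 0.
  have EE (j1 : 'I_d) : E j1 = c j1 by rewrite /E valK.
  suff /polyP/(_ j') : \poly_(j < d) E j = 0 by rewrite coef_poly ltn_ord EE coef0.
  apply: dmin (size_poly _ _) _; rewrite /root poly_def rmorph_sum.
  rewrite horner_sum -[X in _ == X]cx; apply/eqP; apply: eq_bigr => j1 _.
  by rewrite EE /= map_polyZ map_polyXn hornerZ hornerXn.
(* The element [x] is algebraic over [k]: otherwise [size0] would force the nonzero polynomial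
   [('X - x%:P) ^+ n] to vanish. Then [f] is an annihilating polynomial of least size. *)
have [d /asboolP[f [f0 fx fd]] dmin] : {d | ann d & forall d', ann d' -> (d <= d')%N}.
  suff ex : exists d, ann d by case: (ex_minnP ex) => d; exists d.
  apply: contrapT => nex.
  suff /eqP : ('X - x%:P) ^+ n = 0 by rewrite expf_eq0 polyXsubC_eq0 andbF.
  apply: (size0 _ _ (leqnn _) evn) => f _ fx; apply/eqP/negPn/negP => f0; apply: nex; exists (size f).
  by apply/asboolP; exists f.
have {}dmin (g : {poly k}) : (size g < d)%N -> root (map_poly i g) x -> g = 0.
  move=> gd gx; apply/eqP/negPn/negP => g0.
  by move: gd; rewrite ltnNge dmin //; apply/asboolP; exists g.
pose F := map_poly i f.
have sF : size F = d by rewrite size_map_poly.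
have F0 : F != 0 by rewrite map_poly_eq0.
(* The remainder modulo [F] still evaluates to 0 and is shorter than [F], so it vanishes by
   [size0]. *)
have /dvdp_exp_XsubCP[j jn Fj] : F %| ('X - x%:P) ^+ n.
  rewrite /dvdp; apply/eqP.
  have d0 : (0 < d)%N by rewrite -sF size_poly_gt0.
  apply: (@size0 _ d.-1).
  - by rewrite -ltnS prednK // -sF ltn_modp.
  - have := evn; rewrite {1}(divp_eq (('X - x%:P) ^+ n) F) tensor_evalD tensor_evalM.
    by rewrite tensor_eval_root // mulr0 add0r.
  - by move=> g gd; apply: dmin; rewrite -(prednK d0) ltnS.
have dj : d = j.+1 by rewrite -sF (eqp_size Fj) size_exp_XsubC.
(* Exponent 0 contradicts the root. For exponent 1, [f] is linear and gives [x] as a quotient of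
   elements of [k]. For a larger exponent, [x] is a multiple root, so the derivative of [f] vanishes
   by minimality, which is impossible in characteristic 0. *)
case: j jn Fj dj => [|[|j]] _ Fj dj.
- by have := root_size_gt1 F0 fx; rewrite sF dj.
- exists (- f`_0 / f`_1).
  have f1 : f`_1 != 0.
    by rewrite (_ : f`_1 = lead_coef f) ?lead_coef_eq0 // lead_coefE fd dj.
  move: fx; rewrite /root horner_coef sF dj !big_ord_recl big_ord0 !coef_map /=.
  rewrite expr0 expr1 mulr1 addr0 rmorphM rmorphN fmorphV addr_eq0 => /eqP ->.
  by rewrite opprK mulrAC mulfV ?mul1r // fmorph_eq0.
have f'0 : f^`() = 0.
  apply: dmin; first by rewrite -fd lt_size_deriv.
  rewrite -deriv_map -/F (eqpfP Fj) derivZ deriv_exp /root hornerZ hornerMn hornerM.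
  by rewrite horner_exp hornerXsubC subrr /= expr0n mulr0 mul0rn mulr0.
have /polyP/(_ j.+1) := f'0; rewrite coef0 coef_deriv.
have -> : f`_j.+2 = lead_coef f by rewrite lead_coefE fd dj.
by move/eqP; rewrite -mulr_natr mulf_eq0 lead_coef_eq0 (negPf f0) (negPf (char0 _)).
Qed.

End SelfTensor.

(** The residue fields of the tensor square of [K] over [k] serve as [F]: the difference of the two
    copies of [x] lies in every prime, so it is nilpotent, and [nilpotent_difference_base]
    applies. *)
Lemma equalized_base (k K : fieldType) (i : {rmorphism k -> K}) (x : K) :
    (forall n, n.+1%:R != 0 :> k) ->
    (forall (F : fieldType) (a b : {rmorphism K -> F}),
       (forall r, a (i r) = b (i r)) -> a x = b x) ->
  exists y, x = i y.
Proof.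
move=> char0 eqx; apply: contrapT => nx.
have [||p [_ /negP]] := @prime_avoiding (tensor_ring i i) (fun u => u = 0)
  (tensor_inl i i x - tensor_inr i i x).
- by split=> // a u v -> ->; rewrite mulr0 addr0.
- by move=> n /(nilpotent_difference_base char0).
apply; rewrite -to_residue_eq0 rmorphB subr_eq0; apply/eqP.
apply: (eqx _ (@to_residue _ p \o tensor_inl i i) (@to_residue _ p \o tensor_inr i i)).
by move=> r /=; rewrite tensor_in_base.
Qed.

(** Infinitely many rows may satisfy [P], but a finite family of maximal rank over [k] spans all of
    them. *)
Lemma row_span_finite (R : comPzRingType) (k : fieldType) (phi : {rmorphism R -> k}) n
    (P : 'rV[R]_n -> Prop) :
  exists j (U : 'M[R]_(j, n)), (forall i, P (row i U)) /\
    forall r, P r -> (map_mx phi r <= map_mx phi U)%MS.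
Proof.
pose rk d := `[< exists j (U : 'M[R]_(j, n)), (forall i, P (row i U)) /\
  \rank (map_mx phi U) = d >].
have ex : exists d, rk d.
  exists 0%N; apply/asboolP; exists 0%N, 0; split; first by case.
  by rewrite map_mx0 mxrank0.
have bd d : rk d -> (d <= n)%N by move=> /asboolP[j [U [_ <-]]]; apply: rank_leq_col.
have [d /asboolP[j [U [PU Ud]]] dmax] := ex_maxnP ex bd.
exists j, U; split=> // r Pr.
have le_U : (map_mx phi U <= map_mx phi (col_mx U r))%MS.
  by rewrite map_col_mx -addsmxE addsmxSl.
apply: (@submx_trans _ _ _ _ _ _ (map_mx phi (col_mx U r))).
  by rewrite map_col_mx -addsmxE addsmxSr.
rewrite -(geq_leqif (mxrank_leqif_sup le_U)) Ud; apply: dmax; apply/asboolP.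
exists (j + 1)%N, (col_mx U r); split=> // i.
case: (split_ordP i) => i' ->; rewrite ?rowKu ?rowKd //.
by rewrite (_ : row i' r = r) //; apply/rowP => i''; rewrite !mxE [i']ord1.
Qed.

(** Multiplication by the cokernel matrix [Q] turns the class of [s] modulo the span into a vector
    [y]. Any two maps agreeing on [k] agree on [y], so its entries come from [k]. As ranks are
    stable, [y] already has a preimage [s0] under [Q] over [k]. *)
Lemma row_span_equalized (R : comPzRingType) (k K : fieldType)
    (phi : {rmorphism R -> k}) (psi : {rmorphism R -> K}) (i : {rmorphism k -> K})
    n (P : 'rV[R]_n -> Prop) (s : 'rV[K]_n) :
    (forall r, i (phi r) = psi r) -> (forall d, d.+1%:R != 0 :> k) ->
    (forall (F : fieldType) (a b : {rmorphism K -> F}), (forall r, a (i r) = b (i r)) ->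
       row_span P (a \o psi) (map_mx a s - map_mx b s)) ->
  exists s0 : 'rV[k]_n, row_span P psi (map_mx i s0 - s).
Proof.
move=> iP char0 eqs; have [j [U [PU Umax]]] := row_span_finite phi P.
pose Q := cokermx (map_mx phi U); pose y := s *m map_mx i Q.
have /choice[y0 y0E] : forall c, exists z, y 0 c = i z.
  move=> c; apply: equalized_base => // F a b ab.
  suff /matrixP/(_ 0 c) : map_mx a y = map_mx b y by rewrite !mxE.
  have [j' [t [V [PV E]]]] := eqs F a b ab.
  have ai r : (a \o i) (phi r) = (a \o psi) r by rewrite /= iP.
  have Qab : map_mx a (map_mx i Q) = map_mx b (map_mx i Q).
    by apply/matrixP => u v; rewrite !mxE ab.
  apply/eqP; rewrite /y (map_mxM a) (map_mxM b) -Qab -subr_eq0 -mulmxBl E -mulmxA.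
  rewrite (map_mx_factor _ ai) -[map_mx a _]map_mx_comp -map_mxM.
  suff -> : map_mx phi V *m Q = 0 by rewrite map_mx0 mulmx0.
  apply/eqP; rewrite -submxE; apply/row_subP => u.
  by rewrite -map_row; apply: Umax.
pose y1 : 'rV[k]_n := \row_c y0 c.
have yE : y = map_mx i y1 by apply/rowP => c; rewrite y0E !mxE.
have : (y1 <= Q)%MS by rewrite -(map_submx i) -yE submxMl.
case/submxP => s0 s0E; exists s0.
have : (map_mx i s0 - s <= map_mx psi U)%MS.
  by rewrite submxE (map_mx_factor _ iP) -map_cokermx mulmxBl -map_mxM -s0E -yE subrr.
by case/submxP => t tE; exists j, t, U.
Qed.

(** * Descent to regular rings *)

Definition lies_over (T W : comPzRingType) (j : T -> W) (q : spec W) (p : spec T) : Prop :=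
  forall t, (j t \in prime_ideal q) = (t \in prime_ideal p).

(* As the primes of T are maximal, a prime q containing I and disjoint from j (T \ p)
   lies over p. *)
Lemma regular_lying_over (T W : comPzRingType) (j : {rmorphism T -> W}) (p : spec T)
    (I : W -> Prop) : regular_ring T -> is_idealp I ->
    (forall t, I (j t) -> t \in prime_ideal p) ->
  exists q, lies_over j q p /\ forall w, I w -> w \in prime_ideal q.
Proof.
move=> Treg II Ip.
have [||v Iv [t [tp vt]]|q [Iq Zq]] :=
  @prime_disjoint W I (fun v => exists t, t \notin prime_ideal p /\ v = j t) II.
- by exists 1; rewrite rmorph1; split=> //; apply: prime_ideal1.
- move=> _ _ [t [tp ->]] [u [up ->]]; exists (t * u); rewrite rmorphM; split=> //.
  exact: prime_idealM.
- by move: tp; rewrite Ip // -vt.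
exists q; split=> // t; apply/idP/idP => [tq|tp].
  by apply: contraLR tq => tp; apply: Zq; exists t.
have [t' [tE _]] := Treg t; apply: (@prime_idealVl _ q (j (1 - t' * t))).
  apply: Zq; exists (1 - t' * t); split=> //.
  apply/negP => /prime_idealD/(_ (prime_idealMl t' tp)).
  by rewrite subrK; apply/negP/prime_ideal1.
rewrite -rmorphM mulrBl mul1r -{1}tE (_ : _ - _ = 0) ?rmorph0 ?prime_ideal0 //.
by ring.
Qed.

(** The case of the zero ideal in [regular_lying_over]. *)
Lemma regular_incl_surjective (T W : comPzRingType) (j : {rmorphism T -> W}) :
  regular_ring T -> injective j -> spec_surjective j.
Proof.
move=> Treg ji p.
have [||q [qp _]] := @regular_lying_over _ _ j p (fun w => w = 0) Treg.
- by split=> // a u v -> ->; rewrite mulr0 addr0.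
- by move=> t; rewrite -(rmorph0 j) => /ji->; apply: prime_ideal0.
by exists q.
Qed.

Section RegularDescent.
Variables (R T W : comPzRingType) (phi : {rmorphism R -> T}) (j : {rmorphism T -> W}).
Hypotheses (Treg : regular_ring T) (Wreg : regular_ring W).
Hypothesis char0 : forall (p : spec T) n, n.+1%:R != 0 :> residue_field p.
Variables (n : nat) (P : 'rV[R]_n -> Prop) (s : 'rV[W]_n).
Hypothesis eqs : forall (F : fieldType) (a b : {rmorphism W -> F}),
  (forall t, a (j t) = b (j t)) ->
  row_span P ((a \o j) \o phi) (map_mx a s - map_mx b s).

Notation psi := (j \o phi).

Lemma regular_lift_row (p : spec T) m (v : 'rV[residue_field p]_m) :
  exists v', v = map_mx (@to_residue _ p) v'.
Proof.
have [v' vE] := choice (fun i => regular_residue_surj Treg (v 0 i)).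
by exists (\row_i v' i); apply/rowP => i; rewrite !mxE.
Qed.

Lemma lies_over_residue q p : lies_over j q p ->
  forall t, ((@to_residue _ q \o j) t == 0) = (t \in prime_ideal p).
Proof. by move=> qp t; rewrite to_residue_eq0. Qed.

(* Over one prime q1, s descends to the residue field of p by [row_span_equalized];
   over another prime q, the result agrees with s in a compositum of the two
   residue fields. *)
Lemma residue_descent (p : spec T) : exists x : 'rV[T]_n, forall q, lies_over j q p ->
  row_span P (@to_residue _ q \o psi) (map_mx (@to_residue _ q) (map_mx j x - s)).
Proof.
have [[q1 q1p]|nq] := EM (exists q, lies_over j q p); last first.
  by exists 0 => q qp; case: nq; exists q.
pose r q : {rmorphism W -> residue_field q} := @to_residue _ q.
pose rp : {rmorphism T -> residue_field p} := @to_residue _ p.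
pose i q (qp : lies_over j q p) : {rmorphism residue_field p -> residue_field q} :=
  residue_lift (lies_over_residue qp).
have iE q (qp : lies_over j q p) t : i q qp (rp t) = r q (j t).
  exact: residue_lift_residue.
have [|||s0 s0P] := @row_span_equalized R _ _ (rp \o phi) (r q1 \o psi) (i q1 q1p)
    n P (map_mx (r q1) s).
- by move=> a; apply: iE.
- exact: char0.
- move=> F a b ab; rewrite -!map_mx_comp.
  by apply: (eqs (a := a \o r q1) (b := b \o r q1)) => t; rewrite /= -!(iE q1 q1p) ab.
have [x xE] := regular_lift_row s0; exists x => q qp.
have [F [a [b ab]]] := compositum (i q1 q1p) (i q qp).
have s0E q' (qp' : lies_over j q' p) : map_mx (i q' qp') s0 = map_mx (r q') (map_mx j x).
  by rewrite xE -!map_mx_comp; apply: eq_map_mx => t; apply: iE.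
have abj t : (a \o r q1) (j t) = (b \o r q) (j t).
  by rewrite /= -(iE q1 q1p) -(iE q qp) ab.
have bP c : b ((r q \o psi) c) = (((a \o r q1) \o j) \o phi) c by apply/esym/abj.
apply: (row_span_descent bP).
have E1 : row_span P (((a \o r q1) \o j) \o phi)
    (map_mx a (map_mx (i q1 q1p) s0 - map_mx (r q1) s)) by apply: row_span_map s0P.
have := row_spanD E1 (eqs abj).
rewrite !map_mxB !s0E -![map_mx a (map_mx (r q1) _)]map_mx_comp.
rewrite -![map_mx b (map_mx (r q) _)]map_mx_comp addrA subrK.
suff -> : map_mx (a \o r q1) (map_mx j x) = map_mx (b \o r q) (map_mx j x) by [].
by rewrite -!map_mx_comp; apply: eq_map_mx => t; apply: abj.
Qed.

(** The elements [t] of [T] for which some [x] solves the problem after multiplication by [t] form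
    an ideal [J]; it remains to see that no prime contains [J]. *)
Lemma regular_descent : exists x : 'rV[T]_n, row_span P psi (map_mx j x - s).
Proof.
pose J t := exists x, row_span P psi (j t *: (map_mx j x - s)).
have J_ideal : is_idealp J.
  split=> [|a t1 t2 [x1 P1] [x2 P2]].
    by exists 0; rewrite rmorph0 scale0r; apply: row_span0.
  (* The idempotent [e] generates the same ideal as [t1]. The glued solution is [x1] where [e] is 1
     and [x2] where [e] is 0. *)
  have [t1' [t1E _]] := Treg t1; pose e := t1 * t1'.
  exists (e *: x1 + (1 - e) *: x2).
  have E1 : j t1 *: (map_mx j (e *: x1 + (1 - e) *: x2) - s) = j t1 *: (map_mx j x1 - s).
    apply/rowP => c; rewrite !mxE; apply/eqP; rewrite -subr_eq0; apply/eqP.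
    transitivity ((j (t1 * e) - j t1) * (j (x1 0 c) - j (x2 0 c))).
      by rewrite /e !(rmorphM, rmorphD, rmorphB, rmorph1); ring.
    by rewrite /e mulrCA mulrA mulrAC t1E subrr mul0r.
  have E2 : j t2 *: (map_mx j (e *: x1 + (1 - e) *: x2) - s) =
     j (t1' * t2) *: (j t1 *: (map_mx j x1 - s)) + j (1 - e) *: (j t2 *: (map_mx j x2 - s)).
    apply/rowP => c; rewrite !mxE /e !(rmorphM, rmorphD, rmorphB, rmorph1).
    by ring.
  move: E1 E2; set y := map_mx j _ - s => E1 E2.
  rewrite rmorphD rmorphM scalerDl -scalerA E1 E2.
  by apply: row_spanD; [|apply: row_spanD]; apply: row_spanZ => //; apply: row_spanZ.
apply: contrapT => nJ.
have [|p Jp] := prime_containing J_ideal.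
  by move=> [x]; rewrite rmorph1 scale1r => Px; apply: nJ; exists x.
have [x xP] := residue_descent p.
(* If [p] contained [J], the ideal of all [w] that move the error of [x] into the span would lie in
   a prime [q] over [p]. But [x] is a solution at [q], hence near [q]. *)
have [|q [qp Iq]] := @regular_lying_over _ _ j p _ Treg
  (row_span_idealp psi P (map_mx j x - s)).
  by move=> t It; apply: Jp; exists x.
have [w [wq Pw]] := regular_row_span_nbhd Wreg (xP q qp).
by move: wq; rewrite Iq.
Qed.

End RegularDescent.

(** * Closure under quasi-inverses *)

Section RegularClosure.
Variables (A W : comPzRingType) (g : {rmorphism A -> W}).

(** The list is read from its end: each entry is a quasi-inverse of an element generated over [A] by
    the entries after it. *)
Fixpoint tower (t : seq W) : Prop :=
  if t is v :: t' then
    tower t' /\ exists u, u \in sr_pred (gen_subring g t') /\ quasi_inverse u v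
  else True.

Lemma tower_cat t t' : tower t -> tower t' -> tower (t ++ t').
Proof.
elim: t => //= v t IH [/IH tt' [u [ut uv]]] /tt' ctt'; split=> //.
by exists u; split=> //; apply: gen_mono ut => w wt; rewrite mem_cat wt.
Qed.

(* Quasi-inverses are unique, so A -> A[t] is an epimorphism of rings. *)
Lemma tower_epi (t : seq W) (D : comPzRingType) (a b : {rmorphism gen_ring g t -> D}) :
  tower t -> (forall x, a (gen_str g t x) = b (gen_str g t x)) -> forall x, a x = b x.
Proof.
move=> tt ab.
(* The image in [W] of the equalizer of [a] and [b]. *)
pose E : {pred W} := fun u => `[< exists x, gen_incl g t x = u /\ a x = b x >].
have Ec : subring_closed E.
  split=> [|_ _ /asboolP[x [<- xE]] /asboolP[y [<- yE]]
           |_ _ /asboolP[x [<- xE]] /asboolP[y [<- yE]]]; apply/asboolP.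
  - by exists 1; rewrite !rmorph1.
  - by exists (x - y); rewrite !rmorphB xE yE.
  - by exists (x * y); rewrite !rmorphM xE yE.
have gE x : g x \in E by apply/asboolP; exists (gen_str g t x); rewrite gen_strE ab.
have sub t' : tower t' -> {subset t' <= t} -> {subset t' <= E}.
  elim: t' => //= v t' IH [tt' [u [ut' uv]]] vt' w.
  have t'E : {subset t' <= E} by apply: IH => // z zt'; apply: vt'; rewrite in_cons zt' orbT.
  rewrite in_cons => /predU1P[->|/t'E //].
  have /asboolP[x [xu xE]] := gen_min Ec gE t'E ut'.
  have [y yv] := sr_inclK (gen_gens g (vt' v (mem_head _ _))).
  have [xyx yxy] : quasi_inverse x y.
    by case: uv; rewrite -xu -yv /gen_incl => U V;
       split; apply: (@sr_incl_inj _ (gen_subring g t)); rewrite !rmorphM.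
  (* Both [a y] and [b y] are quasi-inverses of the common value [a x = b x]. *)
  apply/asboolP; exists y; split=> //; apply: (@quasi_inverse_uniq _ (a x)).
    by split; rewrite -!rmorphM (xyx, yxy).
  by rewrite xE; split; rewrite -!rmorphM (xyx, yxy).
move=> x; have /asboolP[y [yx yE]] : gen_incl g t x \in E.
  by apply: (gen_min Ec gE (sub t tt _)) => //; apply: sr_inclP.
by move: yE; rewrite (sr_incl_inj yx).
Qed.

(** The union of the subrings generated by towers, which is directed because towers can be
    concatenated. *)
Definition closure_pred : {pred W} := fun u =>
  `[< exists t, tower t /\ u \in sr_pred (gen_subring g t) >].

Lemma closure_collect (l : seq W) : {subset l <= closure_pred} ->
  exists t, tower t /\ {subset l <= sr_pred (gen_subring g t)}.
Proof.
elim: l => [|u l IH] lC; first by exists [::].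
have [z zl|t [tt lt]] := IH; first by apply: lC; rewrite in_cons zl orbT.
have /asboolP[t' [tt' ut']] := lC u (mem_head _ _).
exists (t ++ t'); split; first exact: tower_cat.
move=> z; rewrite in_cons => /predU1P[->|/lt zt].
  by apply: gen_mono ut' => w wt; rewrite mem_cat wt orbT.
by apply: gen_mono zt => w wt; rewrite mem_cat wt.
Qed.

Lemma closure_pair u v : u \in closure_pred -> v \in closure_pred ->
  exists t, [/\ tower t, u \in sr_pred (gen_subring g t) &
    v \in sr_pred (gen_subring g t)].
Proof.
move=> uC vC; have [z|t [tt uvt]] := @closure_collect [:: u; v].
  by rewrite in_cons mem_seq1 => /orP[/eqP->|/eqP->].
by exists t; split=> //; apply: uvt; rewrite in_cons mem_seq1 eqxx ?orbT.
Qed.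

Lemma closure_predP : subring_closed closure_pred.
Proof.
split=> [|u v uC vC|u v uC vC].
- by apply/asboolP; exists [::]; split=> //; case: (gen_predP g [::]).
- have [t [tt ut vt]] := closure_pair uC vC; apply/asboolP; exists t; split=> //.
  by case: (gen_predP g t) => _ B _; apply: B.
- have [t [tt ut vt]] := closure_pair uC vC; apply/asboolP; exists t; split=> //.
  by case: (gen_predP g t) => _ _ M; apply: M.
Qed.

Definition regular_closure : subring W := Subring closure_predP.

Lemma closure_base a : g a \in sr_pred regular_closure.
Proof. by apply/asboolP; exists [::]; split=> //; apply: gen_base. Qed.

(** The quasi-inverse in [W] of an element reached by a tower can be put on top of that tower. *)
Lemma regular_closure_regular : regular_ring W -> regular_ring (sr_type regular_closure).
Proof.
move=> Wreg x; have [v uv] := Wreg (sr_incl _ x).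
have /asboolP[t [tt ut]] := sr_inclP x.
have [|y yv] := @sr_inclK _ regular_closure v.
  apply/asboolP; exists (v :: t); split; last exact/gen_gens/mem_head.
  by split=> //; exists (sr_incl _ x).
by exists y; case: uv; rewrite -yv => U V; split; apply: sr_incl_inj; rewrite !rmorphM.
Qed.

End RegularClosure.

(** * Global sections in characteristic 0 *)

Lemma char0_field_over (R : comPzRingType) : contains_char0_field R ->
  forall (k : fieldType) (phi : {rmorphism R -> k}) d, d.+1%:R != 0 :> k.
Proof.
move=> [F [i [_ /pcharf0P F0]]] k phi d.
by rewrite -(rmorph_nat (phi \o i)) fmorph_eq0 F0.
Qed.

Section MatchingSections.
Variables (R : comPzRingType) (c : algebra_class).
Variables (M : lmodType R) (m : nat) (e : 'I_m -> M).
Hypothesis eG : generating e.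

(* The coverings of the category only see finitely generated subrings of F, but
   those contain the images of a and b. *)
Lemma matching_fields (A C : obj R c) (h : hom A C) (s : 'rV[C]_m) :
    finite_type (obj_str A) -> finite_type h ->
    (forall (D : obj R c) (a b : hom C D), hom_comp a h = hom_comp b h ->
       locally_eq (psh_res (mod_presheaf c M) a (bc_comb e (obj_str C) s))
                  (psh_res (mod_presheaf c M) b (bc_comb e (obj_str C) s))) ->
  forall (F : fieldType) (a b : {rmorphism C -> F}), (forall x, a (h x) = b (h x)) ->
    row_span (relation_row e) (a \o obj_str C) (map_mx a s - map_mx b s).
Proof.
move=> Aft hft match_s F a b ab.
have Cft : finite_type (obj_str C).
  by apply: finite_type_comp Aft hft => r; rewrite hom_str.
pose chi : {rmorphism R -> F} := a \o obj_str C.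
have bchi r : b (obj_str C r) = chi r by rewrite /= -(hom_str h) -ab.
have [ga gaP] := finite_type_image Cft (fun r => erefl (chi r)).
have [gb gbP] := finite_type_image Cft bchi.
pose t := ga ++ gb; pose S := gen_subring chi t.
have aS : forall x, a x \in sr_pred S.
  apply: gaP => [|u ut]; first exact: gen_base.
  by apply: gen_gens; rewrite mem_cat ut.
have bS : forall x, b x \in sr_pred S.
  apply: gbP => [|u ut]; first exact: gen_base.
  by apply: gen_gens; rewrite mem_cat ut orbT.
pose D : obj R c := Obj (finite_type_in_class c (gen_finite_type chi t)).
have aD r : corestr aS (obj_str C r) = obj_str D r by apply: sr_incl_inj.
have bD r : corestr bS (obj_str C r) = obj_str D r.
  by apply: (@sr_incl_inj _ S); rewrite /= bchi.
pose a1 : hom C D := @Hom _ _ C D (corestr aS) aD.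
pose b1 : hom C D := @Hom _ _ C D (corestr bS) bD.
have a1b1 : hom_comp a1 h = hom_comp b1 h.
  by apply: hom_ext => x; apply: (@sr_incl_inj _ S); apply: ab.
have [D' [u [uc]]] := match_s D a1 b1 a1b1.
rewrite !mod_res_comb => /eqP; rewrite -subr_eq0 -raddfB -map_mxB => /eqP.
move=> /(bc_comb_eq0 _ _ eG) Pu.
have : locally_spanned (relation_row e) (map_mx a1 s - map_mx b1 s : 'rV[D]_m).
  by exists D', u.
move=> /locally_spannedE/(_ F (sr_incl S)); rewrite map_mxB -!map_mx_comp.
by [].
Qed.

End MatchingSections.

Section GlobalSections.
Variables (R : comPzRingType) (c : algebra_class).
Variables (N M L : lmodType R) (alpha : {linear N -> M}) (beta : {linear M -> L}).
Variables (m l : nat) (e : 'I_m -> M) (f : 'I_l -> L) (B : 'M[R]_(m, l)).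
Hypotheses (eG : generating e) (fG : generating f).
Hypothesis BE : forall i, beta (e i) = lincomb f (row i B).
Hypothesis alpha_beta : forall n, beta (alpha n) = 0.

Notation PM := (image_row e alpha).
Notation PL := (relation_row f).

(** [beta] carries a relation between the [e i] to one between the generators of [L], with
    coefficients given by [B]. *)
Lemma relation_row_mul (S : comPzRingType) (phi : {rmorphism R -> S}) (s : 'rV[S]_m) :
  row_span (relation_row e) phi s -> row_span PL phi (s *m map_mx phi B).
Proof.
move=> [k [t [U [PU ->]]]]; exists k, t, (U *m B); split; last by rewrite -mulmxA -map_mxM.
move=> i; rewrite row_mul /relation_row.
have := PU i; rewrite /relation_row => /(congr1 beta); rewrite linear0 => <-.
have f0 : lincomb f 0 = 0 by rewrite -(subrr 0) lincombB subrr.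
rewrite mulmx_sum_row (big_morph _ (lincombD f) f0) linear_sum.
by apply: eq_bigr => j _; rewrite lincombZ linearZ /= BE.
Qed.

Section Descent.
Variables (A D : obj R c) (u : hom A D) (s : 'rV[D]_m).
Hypotheses (R0 : contains_char0_field R) (Aft : finite_type (obj_str A)).
Hypothesis uc : covering u.
Hypothesis ex : row_exact_fields alpha e f B.
Hypothesis match_s : forall (E : obj R c) (a b : hom D E),
  hom_comp a u = hom_comp b u ->
  locally_eq (psh_res (mod_presheaf c M) a (bc_comb e (obj_str D) s))
             (psh_res (mod_presheaf c M) b (bc_comb e (obj_str D) s)).
Hypothesis sB : row_span PL (obj_str D) (s *m map_mx (obj_str D) B).

Let W := residue_prod D.
Let toW : {rmorphism D -> W} := @to_prod D.
Let g : {rmorphism A -> W} := toW \o u.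
Let T := sr_type (regular_closure g).
Let j : {rmorphism T -> W} := sr_incl (regular_closure g).
Let gT : {rmorphism A -> T} := corestr (closure_base g).
Let phi : {rmorphism R -> T} := gT \o obj_str A.

Let jphi r : j (phi r) = toW (obj_str D r).
Proof. by rewrite -(hom_str u). Qed.

Let Wreg : regular_ring W. Proof. exact: field_prod_regular. Qed.
Let Treg : regular_ring T. Proof. exact: regular_closure_regular. Qed.

(** The matching condition supplies the hypothesis of [regular_descent]. The equation satisfied by
    [s] then holds for [x] over [W], hence over every residue field of [T] because the spectrum of
    [W] maps onto that of [T], and exactness over the regular ring [T] applies. *)
Lemma closure_descent : exists x : 'rV[T]_m,
  row_span (relation_row e) (toW \o obj_str D) (map_mx j x - map_mx toW s) /\
  row_span PM phi x.
Proof.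
have [p d|F a b ab|x Px] := @regular_descent R T W phi j Treg Wreg _ m (relation_row e)
    (map_mx toW s) _.
- exact: (char0_field_over R0 (@to_residue _ p \o phi)).
- have abu y : (a \o toW) (u y) = (b \o toW) (u y) by apply: (ab (gT y)).
  have := matching_fields eG Aft uc.1 match_s abu.
  rewrite -![map_mx _ (map_mx toW s)]map_mx_comp; apply: row_span_ext => r.
  by congr (a _); rewrite jphi.
have {}Px : row_span (relation_row e) (toW \o obj_str D) (map_mx j x - map_mx toW s).
  exact: row_span_ext Px.
exists x; split=> //.
have sBW : row_span PL (toW \o obj_str D) (map_mx toW s *m map_mx (toW \o obj_str D) B).
  rewrite (@map_mx_factor _ _ _ (obj_str D) (toW \o obj_str D) toW) // -map_mxM.
  exact: row_span_map sB.
apply: (row_exact_regular ex Treg); apply: (regular_row_span Treg) => p.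
have js : spec_surjective j := regular_incl_surjective Treg (@sr_incl_inj _ _).
apply: (row_span_surjective js (psi := toW \o obj_str D)) => //.
rewrite map_mxM -(map_mx_factor B jphi).
rewrite -[map_mx j x](subrK (map_mx toW s)) mulmxDl; apply: row_spanD => //.
exact: relation_row_mul.
Qed.

(** [S] is generated over [A] by a tower [t] that reaches the entries of [x] and the coefficients of
    its solution; this makes [v] an epimorphism. [E] is generated over [D] by [t] and the
    coefficients of the congruence between [x] and [s], so that the two sections can be compared
    there. *)
Lemma section_descent : exists (S : obj R c) (v : hom A S) (y : base_change (obj_str S) N),
  [/\ covering v,
      forall (E : obj R c) (a b : hom S E), hom_comp a v = hom_comp b v -> a = b &
      exists (E : obj R c) (a : hom S E) (b : hom D E),
        [/\ covering b, hom_comp a v = hom_comp b u &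
          psh_res (mod_presheaf c M) a (bc_map (obj_str S) alpha y) =
          psh_res (mod_presheaf c M) b (bc_comb e (obj_str D) s)]].
Proof.
have [x [/row_span_coeffs[w wP] [k [r [U [PU xE]]]]]] := closure_descent.
pose entries n (z : 'rV[T]_n) := [seq j (z 0 i) | i <- enum 'I_n].
have [z|t [tt lt]] := @closure_collect _ _ g (entries _ x ++ entries _ r).
  by rewrite mem_cat => /orP[] /mapP[i _ ->]; apply: sr_inclP.
have lift n (z : 'rV[T]_n) : {subset entries n z <= sr_pred (gen_subring g t)} ->
    exists z', map_mx j z = map_mx (gen_incl g t) z'.
  move=> zt; apply: sr_lift_row => i; rewrite mxE; apply: zt; apply/mapP.
  by exists i; rewrite ?mem_enum.
have [z zx|x' x'E] := lift _ x; first by apply: lt; rewrite mem_cat zx.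
have [z zx|r' r'E] := lift _ r; first by apply: lt; rewrite mem_cat zx orbT.
pose S := ext_obj (gen_finite_type g t); pose v : hom A S := ext_hom (gen_finite_type g t).
have gS y : gen_incl g t (obj_str S y) = toW (obj_str D y).
  by rewrite -(hom_str u).
have /(row_span_bc_comb (phi := obj_str S))[y yE] : row_span PM (obj_str S) x'.
  exists k, r', U; split=> //; apply: (map_mx_inj_fun (@sr_incl_inj _ (gen_subring g t))).
  rewrite -[LHS]x'E xE map_mxM -(map_mx_factor U jphi) r'E map_mxM.
  by rewrite -(map_mx_factor U gS).
exists S, v, y; split.
- split; first exact: gen_finite_type.
  apply: gen_surjective; apply: (spec_surjective_comp (g := toW) (f := u)) => //.
    by case: uc.
  exact: to_prod_surjective.
- move=> E a b ab; apply: hom_ext; apply: tower_epi => // z.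
  by have := congr1 (fun h : hom A E => h z) ab.
pose V := gen_subring toW (t ++ w).
have gV : {subset sr_pred (gen_subring g t) <= sr_pred V}.
  apply: gen_min => [|a|z zt]; [exact: sr_closed | exact: gen_base |].
  by apply: gen_gens; rewrite mem_cat zt.
pose Eft := gen_finite_type toW (t ++ w); pose E := ext_obj Eft.
have inV (z : S) : gen_incl g t z \in sr_pred V by apply/gV/sr_inclP.
have aE q : corestr inV (obj_str S q) = obj_str E q.
  by apply: (@sr_incl_inj _ V); apply: gS.
pose a : hom S E := @Hom _ _ S E (corestr inV) aE.
exists E, a, (ext_hom Eft); split.
- by split=> //; apply/gen_surjective/to_prod_surjective.
- by apply: hom_ext => q; apply: (@sr_incl_inj _ V).
rewrite yE !mod_res_comb; apply/eqP; rewrite -subr_eq0 -raddfB; apply/eqP.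
apply/(bc_comb_eq0 _ _ eG); apply: (wP V) => [q|q qw|].
- exact: gen_strE.
- by apply: gen_gens; rewrite mem_cat qw orbT.
- by rewrite map_mxB -!map_mx_comp x'E.
Qed.

End Descent.

Lemma fields_sections_exact (A : obj R c) : contains_char0_field R ->
    finite_type (obj_str A) -> row_exact_fields alpha e f B ->
  sections_exact (mod_morphism c alpha) (mod_morphism c beta) A.
Proof.
move=> R0 Aft ex s; split=> [|[t]]; last exact: push_push_eq0.
move=> /push_eq0_cover[D [u [d [uc du]]]].
have [s' s'E] := bc_comb_surj eG (psh_res (mod_presheaf c M) d (sec_val s)).
have match_s (E : obj R c) (a b : hom D E) : hom_comp a u = hom_comp b u ->
    locally_eq (psh_res (mod_presheaf c M) a (bc_comb e (obj_str D) s'))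
               (psh_res (mod_presheaf c M) b (bc_comb e (obj_str D) s')).
  move=> ab; rewrite -s'E -!psh_res_comp; apply: sec_matching.
  by move: ab; rewrite -du => /(congr1 (fun h : hom A E => (h : A -> E))) ab;
     apply: hom_ext => z; apply: (congr1 (fun h => h z) ab).
rewrite s'E => /(bc_map_comb_eq0 fG BE) s'B.
have [S [v [y [vc epi [E [a [b [bc ab abE]]]]]]]] := section_descent R0 Aft uc ex match_s s'B.
(* Two maps out of [S] that agree on [A] are equal, so any element over [S] defines a section over
   [A]. *)
have y_matching (C : obj R c) (p q : hom S C) : hom_comp p v = hom_comp q v ->
    locally_eq (psh_res (mod_presheaf c N) p y) (psh_res (mod_presheaf c N) q y).
  by move=> /epi->; apply: locally_eq_refl.
exists (SheafSection vc y_matching), E, (hom_comp b u), a, (hom_comp b d).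
split; rewrite ?hom_comp_idr //; first exact: covering_comp.
- by rewrite -du; apply: hom_ext.
- by rewrite psh_res_comp s'E -abE.
Qed.

End GlobalSections.

(** * The equivalence of the conditions *)

Lemma fg_generating (R : comPzRingType) (M : lmodType R) :
  fg_module M -> exists n (e : 'I_n -> M), generating e.
Proof.
move=> [n [e eP]]; exists n, e => x; have [c ->] := eP x.
by exists (\row_i c i); apply: eq_bigr => i _; rewrite mxE.
Qed.

Theorem theorem3p9p1 (R : comPzRingType) (N M L : lmodType R)
    (alpha : {linear N -> M}) (beta : {linear M -> L})
    (fgN : fg_module N) (fgM : fg_module M) (fgL : fg_module L)
    (alpha_beta : forall n, beta (alpha n) = 0)
    (c : algebra_class) :
  [<-> (* (i) *)
       sheaf_exact (mod_morphism c alpha) (mod_morphism c beta);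
       (* (ii) *)
       forall (R' : obj R c) (m : base_change (obj_str R') M),
         bc_map (obj_str R') beta m = 0 ->
         in_radical (image_of (bc_map (obj_str R') alpha)) m;
       (* (iv) *)
       forall (K : fieldType) (k : {rmorphism R -> K}), exact_after k alpha beta]
  /\
  (* (iii) <-> (iv), for every choice of the algebraic closures *)
  (forall kbar : forall x : spec R, algebraic_closure (residue_field x),
     exact_after (to_rad kbar) alpha beta <->
     (forall (K : fieldType) (k : {rmorphism R -> K}), exact_after k alpha beta))
  /\
  (* (v) <-> (iv) *)
  (noetherian R -> finite_krull_dim R -> contains_char0_field R ->
     (forall R' : obj R c, finite_type (obj_str R') ->
        sections_exact (mod_morphism c alpha) (mod_morphism c beta) R') <->
     (forall (K : fieldType) (k : {rmorphism R -> K}), exact_after k alpha beta)).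
Proof.
have [m [e eG]] := fg_generating fgM; have [l [f fG]] := fg_generating fgL.
have [b bE] := choice (fun i => fG (beta (e i))).
pose B : 'M[R]_(m, l) := \matrix_i b i.
have BE i : beta (e i) = lincomb f (row i B) by rewrite rowK.
(* With generators fixed, (iv) becomes solvability of linear systems over fields, the form in which
   the other conditions are compared with it. *)
have fieldsE : (forall (K : fieldType) (k : {rmorphism R -> K}), exact_after k alpha beta)
    <-> row_exact_fields alpha e f B.
  by split=> ex K k; apply/(exact_afterE eG fG BE alpha_beta)/ex.
split; [|split].
- tfae.
  + exact: sheaf_exact_radical eG fG BE.
  + by move=> /(radical_row_exact_fields eG fG BE)/fieldsE.
  + by move=> /fieldsE/(fields_sheaf_exact (c := c) eG fG BE).
- move=> kbar; apply: iff_trans (iff_sym fieldsE).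
  apply: iff_trans (row_exact_radE alpha e f B kbar).
  exact: exact_afterE.
- move=> _ _ R0; split=> [ex|/fieldsE ex A Aft].
    by apply/fieldsE/(sections_exact_row_exact_fields (c := c)).
  exact: fields_sections_exact ex.
Qed.
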